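(* Let $Q$ be a quiver and let $\boldsymbol\alpha\le\boldsymbol n$ be dimension vectors for $Q$. Then $\boldsymbol\alpha\le_Q\boldsymbol n$ if and only if $\langle\boldsymbol\beta,\boldsymbol n-\boldsymbol\beta\rangle\ge 0$ for all $\boldsymbol\beta\le_Q\boldsymbol\alpha$.
   Context: A quiver $Q=(Q_0,Q_1)$ has a finite vertex set $Q_0$ and a finite arrow set $Q_1$ (cycles and multiple arrows allowed); $a\colon x\to y$ denotes an arrow. A dimension vector is a family $\boldsymbol n=(n_x)_{x\in Q_0}$ of nonnegative integers; $\boldsymbol\alpha\le\boldsymbol n$ means $\alpha_x\le n_x$ for all $x$. The Euler form is $$\langle\boldsymbol\alpha,\boldsymbol\beta\rangle=\sum_{x\in Q_0}\alpha_x\beta_x-\sum_{a\colon x\to y\in Q_1}\alpha_x\beta_y .$$ Let $\mathcal V=(V_x)_{x\in Q_0}$ be a family of finite-dimensional complex vector spaces with $\dim V_x=n_x$. A representation of $Q$ on $\mathcal V$ is $v=(v_a)\in\bigoplus_{a\colon x\to y}\mathrm{Hom}(V_x,V_y)$; a subrepresentation of $v$ is a family of subspaces $S_x\subseteq V_x$ with $v_aS_x\subseteq S_y$ for every arrow $a\colon x\to y$. We write $\boldsymbol\alpha\le_Q\boldsymbol n$ ($\boldsymbol\alpha$ is a Schofield subdimension vector) if $\boldsymbol\alpha\le\boldsymbol n$ and every representation $v$ of $Q$ on $\mathcal V$ has a subrepresentation $\mathcal S=(S_x)$ with $\dim S_x=\alpha_x$ for all $x$; this depends only on $\boldsymbol\alpha,\boldsymbol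 n$. *)

(* Defs.v *)
From HB Require Import structures.
From mathcomp Require Import all_boot all_order all_algebra.
From mathcomp Require Import reals complex.
Set Implicit Arguments.
Unset Strict Implicit.
Unset Printing Implicit Defensive.
Import Order.TTheory GRing.Theory Num.Theory.
Import VectorInternalTheory.
Local Open Scope ring_scope.

Record quiver := Quiver {
  vertex : finType;
  arrow : finType;
  src : arrow -> vertex;
  tgt : arrow -> vertex
}.

Definition dimvec (Q : quiver) := {ffun vertex Q -> nat}.

Definition dimvec_le (Q : quiver) (alpha n : dimvec Q) : Prop :=
  forall x, (alpha x <= n x)%N.

(* Dimension vectors seen in the lattice of integer vectors, so that the
   difference of two of them is not truncated. *)
Definition dimz (Q : quiver) (n : dimvec Q) : {ffun vertex Q -> int} :=
  [ffun x => (n x)%:Z].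

Definition euler_form (Q : quiver) (alpha beta : {ffun vertex Q -> int}) : int :=
  \sum_(x : vertex Q) alpha x * beta x
  - \sum_(a : arrow Q) alpha (src a) * beta (tgt a).

Section Representations.

Variables (K : fieldType) (Q : quiver).

Definition rep (V : vertex Q -> vectType K) : Type :=
  forall a : arrow Q, 'Hom(V (src a), V (tgt a)).

Definition subrep (V : vertex Q -> vectType K) (v : rep V)
    (S : forall x, {vspace V x}) : Prop :=
  forall a : arrow Q, (v a @: S (src a) <= S (tgt a))%VS.

Definition all_reps_have_subrep (V : vertex Q -> vectType K)
    (alpha : dimvec Q) : Prop :=
  forall v : rep V, exists S : forall x, {vspace V x},
    subrep v S /\ forall x, \dim (S x) = alpha x.

(* The family of spaces is taken to be K^(n x); by schofield_subE below, any
   other family with the same dimensions gives the same relation. *)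
Definition schofield_sub (alpha n : dimvec Q) : Prop :=
  dimvec_le alpha n
  /\ all_reps_have_subrep (fun x => 'rV[K]_(n x) : vectType K) alpha.

Lemma eq_dim_lfun_inv (V W : vectType K) :
  \dim {: V} = \dim {: W} ->
  exists (f : 'Hom(V, W)) (g : 'Hom(W, V)), cancel f g /\ cancel g f.
Proof.
rewrite !dimvf => dimVW.
pose f (u : V) : W := r2v (castmx (erefl, dimVW) (v2r u)).
pose g (u : W) : V := r2v (castmx (erefl, esym dimVW) (v2r u)).
have lin_f : linear f.
  move=> c u w; rewrite /f -linearP; congr r2v; rewrite linearP.
  by apply/matrixP=> i j; rewrite !(castmxE, mxE).
have lin_g : linear g.
  move=> c u w; rewrite /g -linearP; congr r2v; rewrite linearP.
  by apply/matrixP=> i j; rewrite !(castmxE, mxE).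
pose fL : {linear V -> W} :=
  HB.pack f (GRing.isLinear.Build K V W *:%R f lin_f).
pose gL : {linear W -> V} :=
  HB.pack g (GRing.isLinear.Build K W V *:%R g lin_g).
exists (linfun fL), (linfun gL).
split=> u; rewrite !lfunE /= /f /g r2vK.
  by rewrite castmx_comp castmx_id v2rK.
by rewrite castmx_comp castmx_id v2rK.
Qed.

Lemma all_reps_have_subrep_iso (V W : vertex Q -> vectType K)
    (alpha : dimvec Q) :
  (forall x, \dim {: V x} = \dim {: W x}) ->
  all_reps_have_subrep V alpha -> all_reps_have_subrep W alpha.
Proof.
move=> dimVW HV w.
have /fin_all_exists[f /fin_all_exists[g fgP]] x := eq_dim_lfun_inv (dimVW x).
have [S [subS dimS]] := HV (fun a => (g (tgt a) \o w a \o f (src a))%VF).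
exists (fun x => f x @: S x)%VS; split=> [a | x].
  have := limgS (f (tgt a)) (subS a).
  rewrite !limg_comp; congr (_ <= _)%VS; rewrite -limg_comp.
  rewrite (_ : (f (tgt a) \o g (tgt a))%VF = \1%VF) ?lim1g //.
  by apply/lfunP=> u; rewrite comp_lfunE id_lfunE (proj2 (fgP _)).
rewrite limg_dim_eq ?dimS //.
suff /eqP->: lker (f x) == 0%VS by rewrite capv0.
by apply/lker0P; apply: can_inj (proj1 (fgP x)).
Qed.

Lemma schofield_subE (V : vertex Q -> vectType K) (alpha n : dimvec Q) :
  (forall x, \dim {: V x} = n x) ->
  schofield_sub alpha n <-> dimvec_le alpha n /\ all_reps_have_subrep V alpha.
Proof.
move=> dimV.
have dimE x : \dim {: V x} = \dim {: 'rV[K]_(n x)}.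
  by rewrite dimV dimvf /dim /= mul1n.
by split=> -[le_an H]; split=> //; apply: all_reps_have_subrep_iso H => x.
Qed.

End Representations.

(* Main.v *)
(* Write [b <=_Q d] for "every representation of dimension d has a
   subrepresentation of dimension b", V, W for representations of dimensions
   alpha and gamma = n - alpha.

   Necessity: [<=_Q] is transitive, and [b <=_Q n] forces [<b, n - b> >= 0],
   for otherwise the pairs (representation, subrepresentation) have too few
   parameters; a count of monomials then produces a hypersurface containing all
   representations.

   Sufficiency: if Ext(V, W) = 0 for some V, W, then a power series argument
   shows that the representations having a subrepresentation of dimension alpha
   are Zariski dense; they form a constructible set (quantifier elimination)
   that is closed (compactness of Grassmannians), so [alpha <=_Q n]. If Ext(V, W)
   never vanishes, take a generic f : V -> W, with kernel S of dimension b and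
   cokernel C. Then Hom(S, C) = 0 <> Ext(S, C), so [<b, dim C> < 0], and
   [b <=_Q alpha]. Either f = 0 and [<alpha, gamma> < 0], or Ext never vanishes
   in dimensions (b, gamma) either and one concludes by induction: some
   [b <=_Q alpha] satisfies [<b, gamma> < 0]. For [b] minimizing [<b, gamma>] and
   then of minimal size, the generic Hom from b to alpha - b vanishes, so that
   [<b, alpha - b> <= 0] and [<b, n - b> < 0]. *)
Require Import Defs.
From HB Require Import structures.
From mathcomp Require Import all_boot all_order all_fingroup all_algebra.
From mathcomp Require Import closed_field ring zify.
From mathcomp Require Import boolp classical_sets filter topology normedtype sequences.
From mathcomp Require Import reals complex.
Set Implicit Arguments.
Unset Strict Implicit.
Unset Printing Implicit Defensive.
Import Order.TTheory GRing.Theory Num.Theory.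
Import numFieldNormedType.Exports.
Local Open Scope ring_scope.

(** * Matrices depending polynomially on a parameter *)

Section Cofinite.

Variable K : numFieldType.

(** The exceptional set is cut out by a polynomial, so that a finite intersection is handled by a
    product. *)
Definition cofin (P : K -> Prop) : Prop :=
  exists2 p : {poly K}, p != 0 & forall t, p.[t] != 0 -> P t.

Lemma cofinW (P P' : K -> Prop) :
  (forall t, P t -> P' t) -> cofin P -> cofin P'.
Proof. by move=> sPP' [p p0 Pp]; exists p => // t /Pp /sPP'. Qed.

Lemma cofinI (P P' : K -> Prop) :
  cofin P -> cofin P' -> cofin (fun t => P t /\ P' t).
Proof.
move=> [p p0 Pp] [q q0 Pq]; exists (p * q); first by rewrite mulf_neq0.
by move=> t; rewrite hornerM mulf_eq0 negb_or => /andP[/Pp ? /Pq].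
Qed.

Lemma cofinT (P : K -> Prop) : (forall t, P t) -> cofin P.
Proof. by move=> PT; exists 1; rewrite ?oner_eq0. Qed.

Lemma cofin_all (T : finType) (P : T -> K -> Prop) :
  (forall x, cofin (P x)) -> cofin (fun t => forall x, P x t).
Proof.
move=> /fin_all_exists2[p p0 Pp].
exists (\prod_x p x); first by apply/prodf_neq0 => x _; apply: p0.
by move=> t; rewrite horner_prod => /prodf_neq0 pt x; apply/Pp/pt.
Qed.

Lemma poly_nonroot_seq (p : {poly K}) (s : seq K) :
  p != 0 -> uniq s -> (size p <= size s)%N -> exists2 t, t \in s & p.[t] != 0.
Proof.
move=> p0 us ps; apply/hasP/negPn; rewrite -all_predC.
apply/negP => /allP root_s.
suff : (size s < size p)%N by rewrite ltnNge ps.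
by apply: max_poly_roots => //; apply/allP => t /root_s /= /negPn.
Qed.

(** In characteristic zero the integers above [c] are distinct, so [size p] of them cannot all be
    roots of [p]. This provides parameters tending to infinity. *)
Lemma cofin_large (P : K -> Prop) (c : nat) :
  cofin P -> exists2 m : nat, (c < m)%N & P m%:R.
Proof.
move=> [p p0 Pp].
have /(poly_nonroot_seq p0) : uniq [seq i%:R : K | i <- iota c.+1 (size p)].
  by rewrite map_inj_uniq ?iota_uniq // => i j /eqP; rewrite eqr_nat => /eqP.
rewrite size_map size_iota => /(_ (leqnn _))[_ /mapP[i + ->] /Pp].
by rewrite mem_iota => /andP[ci _] Pi; exists i.
Qed.

Lemma cofin_ex (P : K -> Prop) : cofin P -> exists t, P t.
Proof. by case/(cofin_large 0) => m; exists m%:R. Qed.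

Lemma cofin_poly_eq0 (p : {poly K}) : cofin (fun t => p.[t] = 0) -> p = 0.
Proof.
move=> [q q0 pq]; apply/eqP/negPn/negP => p0.
have [t] : exists t, p.[t] <> 0 /\ p.[t] = 0.
  by apply/cofin_ex/cofinI; [exists p => // t /eqP | exists q].
by case.
Qed.

Lemma cofin_poly (p : {poly K}) : p != 0 -> cofin (fun t => p.[t] != 0).
Proof. by exists p. Qed.

End Cofinite.

Section MatrixCurves.

Variable K : numFieldType.

Definition mxev (m n : nat) (t : K) (M : 'M[{poly K}]_(m, n)) : 'M[K]_(m, n) :=
  map_mx (horner_eval t) M.

Definition mxtan (m n : nat) (M : 'M[{poly K}]_(m, n)) : 'M[K]_(m, n) :=
  map_mx (fun p => p^`().[0]) M.

Definition mxC (m n : nat) (M : 'M[K]_(m, n)) : 'M[{poly K}]_(m, n) :=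
  map_mx polyC M.

Lemma mxevE m n t (M : 'M_(m, n)) i j : mxev t M i j = (M i j).[t].
Proof. by rewrite mxE /horner_eval. Qed.

Lemma mxevM m n p t (A : 'M_(m, n)) (B : 'M_(n, p)) :
  mxev t (A *m B) = mxev t A *m mxev t B.
Proof. exact: map_mxM. Qed.

Lemma mxevD m n t (A B : 'M_(m, n)) : mxev t (A + B) = mxev t A + mxev t B.
Proof. exact: map_mxD. Qed.

Lemma mxevB m n t (A B : 'M_(m, n)) : mxev t (A - B) = mxev t A - mxev t B.
Proof. exact: map_mxB. Qed.

Lemma mxevZ m n t a (A : 'M_(m, n)) : mxev t (a *: A) = a.[t] *: mxev t A.
Proof. exact: map_mxZ. Qed.

Lemma mxev0 m n t : mxev t 0 = 0 :> 'M_(m, n).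
Proof. exact: map_mx0. Qed.

Lemma mxevC m n t (A : 'M_(m, n)) : mxev t (mxC A) = A.
Proof. by apply/matrixP => i j; rewrite mxevE !mxE hornerC. Qed.

Lemma mxtanM m n p (A : 'M_(m, n)) (B : 'M_(n, p)) :
  mxtan (A *m B) = mxtan A *m mxev 0 B + mxev 0 A *m mxtan B.
Proof.
apply/matrixP => i j; rewrite !mxE [(\sum_k _)^`()]raddf_sum horner_sum -big_split /=.
by apply: eq_bigr => k _; rewrite derivM hornerD !hornerM !mxE.
Qed.

Lemma mxtanD m n (A B : 'M_(m, n)) : mxtan (A + B) = mxtan A + mxtan B.
Proof. by apply/matrixP => i j; rewrite !mxE derivD hornerD. Qed.

Lemma mxtanN m n (A : 'M_(m, n)) : mxtan (- A) = - mxtan A.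
Proof. by apply/matrixP => i j; rewrite !mxE derivN hornerN. Qed.

Lemma mxtanC m n (A : 'M_(m, n)) : mxtan (mxC A) = 0.
Proof. by apply/matrixP => i j; rewrite !mxE derivC horner0. Qed.

Lemma mxtan0 m n : mxtan 0 = 0 :> 'M_(m, n).
Proof. by apply/matrixP => i j; rewrite !mxE deriv0 horner0. Qed.

Lemma mxtanXZ m n (A : 'M_(m, n)) : mxtan ('X *: A) = mxev 0 A.
Proof.
apply/matrixP => i j.
by rewrite !mxE derivM derivX mul1r hornerD hornerM hornerX mul0r addr0.
Qed.

(** Invert [col_base M] on the left and [row_base M] on the right. The rank is then witnessed by an
    invertible square matrix, hence by a determinant. *)
Lemma mx_unit_sandwich m n (M : 'M[K]_(m, n)) :
  exists (P : 'M_(\rank M, m)) (Q : 'M_(n, \rank M)), P *m M *m Q = 1%:M.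
Proof.
have /row_fullP[P PC] := col_base_full M.
have /row_freeP[Q RQ] := row_base_free M.
exists P, Q.
have -> : P *m M = P *m (col_base M *m row_base M) by rewrite mulmx_base.
by rewrite mulmxA PC mul1mx RQ.
Qed.

(** Lower semicontinuity: the determinant of [P M Q] has value 1 at 0, and wherever it is nonzero
    the rank has not dropped. *)
Lemma cofin_rank_ge m n (M : 'M[{poly K}]_(m, n)) :
  cofin (fun t => \rank (mxev 0 M) <= \rank (mxev t M))%N.
Proof.
have [P [Q PMQ]] := mx_unit_sandwich (mxev 0 M).
exists (\det (mxC P *m M *m mxC Q)).
  apply/eqP => /(congr1 (horner_eval 0)).
  rewrite -det_map_mx !map_mxM -!/(mxev _ _) !mxevC PMQ det1 /horner_eval horner0.
  by move/eqP; rewrite oner_eq0.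
move=> t; rewrite -/(horner_eval _ _) -det_map_mx !map_mxM -!/(mxev _ _) !mxevC.
rewrite -unitfE -unitmxE => PMQu.
rewrite -{1}(mxrank_unit PMQu); apply: leq_trans (mxrankM_maxl _ _) _.
exact: mxrankM_maxr.
Qed.

(* Cramer's rule: with [P M(0) Q = 1] and [A = P M Q], the vector
   [det A u - u M Q adj(A) P] is killed by [M Q], hence by [M], whose column
   space at a generic point is that of [M Q]. *)
Lemma kernel_curve m n (M : 'M[{poly K}]_(m, n)) (u : 'rV[K]_m) :
    cofin (fun t => \rank (mxev t M) <= \rank (mxev 0 M))%N ->
    u *m mxev 0 M = 0 ->
  exists2 U : 'rV[{poly K}]_m, mxev 0 U = u & U *m M = 0.
Proof.
move=> rkM uM0.
have [P [Q PMQ]] := mx_unit_sandwich (mxev 0 M).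
pose A := mxC P *m M *m mxC Q.
have A0 : mxev 0 A = 1%:M by rewrite !mxevM !mxevC.
pose U := \det A *: mxC u - mxC u *m M *m mxC Q *m \adj A *m mxC P.
have UMQ : U *m M *m mxC Q = 0.
  rewrite !mulmxBl -!mulmxA [mxC P *m _]mulmxA -/A mul_adj_mx mul_mx_scalar.
  by rewrite -!scalemxAr -!scalemxAl !mulmxA subrr.
exists U.
  rewrite mxevB mxevZ !mxevM !mxevC uM0 !mul0mx subr0.
  rewrite -[X in X *: _]/(horner_eval 0 _) -det_map_mx -/(mxev _ _) A0 det1.
  by rewrite scale1r.
apply/matrixP => i j; rewrite [RHS]mxE; apply: cofin_poly_eq0.
have := cofin_rank_ge A; rewrite A0 mxrank1 => rkA.
apply: cofinW (cofinI rkM rkA) => t [{}rkM {}rkA].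
rewrite -mxevE mxevM.
have rkAMQ : (\rank (mxev t A) <= \rank (mxev t M *m Q))%N.
  by rewrite /A -mulmxA mxevM mxevM !mxevC; apply: mxrankM_maxr.
have : ((mxev t M)^T <= (mxev t M *m Q)^T)%MS.
  rewrite -(geq_leqif (mxrank_leqif_sup _)).
    by rewrite !mxrank_tr (leq_trans rkM) // (leq_trans rkA).
  by rewrite trmx_mul submxMl.
case/submxP => Y /(congr1 trmx); rewrite trmx_mul !trmxK => ->.
by rewrite !mulmxA -mxevM -[Q](mxevC t) -mxevM UMQ mxev0 mul0mx mxE.
Qed.

(** Differentiating [U M = 0] at 0 along a curve of kernel vectors through [u] gives
    [u M'(0) = - U'(0) M(0)]. *)
Lemma rank_tangent m n (M : 'M[{poly K}]_(m, n)) (u : 'rV[K]_m) :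
    cofin (fun t => \rank (mxev t M) <= \rank (mxev 0 M))%N ->
    u *m mxev 0 M = 0 ->
  (u *m mxtan M <= mxev 0 M)%MS.
Proof.
move=> rkM /(kernel_curve rkM)[U U0 /(congr1 (@mxtan _ _))].
rewrite mxtanM mxtan0 U0 => /eqP; rewrite addrC addr_eq0 => /eqP->.
by rewrite eqmx_opp submxMl.
Qed.

End MatrixCurves.

(** * Matrix representations and their subrepresentations *)

Section Splittings.

Variable K : fieldType.

(** A split exact sequence on row vectors: [B] is the inclusion and [Bi] its retraction, [C] the
    projection to the quotient and [Ci] its section. *)
Definition split_mx (b c n : nat) (B : 'M[K]_(b, n)) (Bi : 'M[K]_(n, b))
    (C : 'M[K]_(n, c)) (Ci : 'M[K]_(c, n)) : Prop :=
  [/\ B *m Bi = 1%:M, B *m C = 0, Ci *m Bi = 0, Ci *m C = 1%:M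
    & Bi *m B + C *m Ci = 1%:M].

(** Complete [B] to an invertible matrix [G]; the other three matrices are blocks of [G] and of its
    inverse. *)
Lemma row_free_split b c n (B : 'M[K]_(b, n)) :
  row_free B -> (b + c = n)%N -> exists Bi (C : 'M_(n, c)) Ci, split_mx B Bi C Ci.
Proof.
move=> freeB bc; subst n.
have [G uG eB] : exists2 G : 'M_(b + c), G \in unitmx & B = usubmx G.
  have rB : \rank B = b by apply/eqP.
  exists (block_mx (col_ebase B) 0 0 1%:M *m row_ebase B).
    rewrite unitmx_mul row_ebase_unit andbT unitmxE det_ublock det1 mulr1.
    by rewrite -unitmxE col_ebase_unit.
  rewrite -mul_usub_mx /block_mx col_mxKu -[LHS]mulmx_ebase rB; congr (_ *m _).
  by rewrite pid_mx_row mul_mx_row mulmx1 mulmx0.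
pose V := invmx G.
have GV : G *m V = 1%:M by apply: mulmxV.
have VG : V *m G = 1%:M by apply: mulVmx.
exists (lsubmx V), (rsubmx V), (dsubmx G).
have := GV; rewrite -{1}[G]vsubmxK -{1}[V]hsubmxK mul_col_row scalar_mx_block.
rewrite -eB => /eq_block_mx[BBi BC CiBi CiC]; split=> //.
by rewrite eB -mul_row_col hsubmxK vsubmxK.
Qed.

Lemma split_mx_free b c n (B : 'M_(b, n)) Bi (C : 'M_(n, c)) Ci :
  split_mx B Bi C Ci -> row_free B.
Proof. by case=> BBi _ _ _ _; apply/row_freeP; exists Bi. Qed.

Lemma split_mx_sub b c n (B : 'M_(b, n)) Bi (C : 'M_(n, c)) Ci p (X : 'M_(p, n)) :
  split_mx B Bi C Ci -> ((X <= B)%MS <-> X *m C = 0).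
Proof.
move=> [BBi BC CiBi CiC tot]; split=> [/submxP[D ->] | XC].
  by rewrite -mulmxA BC mulmx0.
by rewrite -[X]mulmx1 -tot mulmxDr !mulmxA XC mul0mx addr0 submxMl.
Qed.

End Splittings.

Section MatrixRepresentations.

Variables (K : fieldType) (Q : quiver).
Implicit Types b c d m n : vertex Q -> nat.

(* Vectors are rows: the matrix of an arrow acts on the right. *)
Definition mrep (d : vertex Q -> nat) : Type :=
  forall a : arrow Q, 'M[K]_(d (src a), d (tgt a)).

Definition has_sub (b d : vertex Q -> nat) (v : mrep d) : Prop :=
  exists B : forall x, 'M[K]_(b x, d x), (forall x, row_free (B x))
    /\ forall a, (B (src a) *m v a <= B (tgt a))%MS.

Definition gen_sub (b d : vertex Q -> nat) : Prop :=
  forall v : mrep d, has_sub b v.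

Lemma has_sub_le b d (v : mrep d) x : has_sub b v -> (b x <= d x)%N.
Proof. by case=> B [/(_ x) /eqP <- _]; apply: rank_leq_col. Qed.

Lemma gen_sub_le b d x : gen_sub b d -> (b x <= d x)%N.
Proof. by move=> /(_ (fun=> 0)); apply: has_sub_le. Qed.

Lemma gen_sub_refl d : gen_sub d d.
Proof.
move=> v; exists (fun x => 1%:M); split=> x; last exact: submx1.
by rewrite row_free_unit unitmx1.
Qed.

Lemma gen_sub_trans b c d : gen_sub b c -> gen_sub c d -> gen_sub b d.
Proof.
move=> sbc scd v; have [C [freeC /(_ _)/submxP subC]] := scd v.
have [w vw] := fin_all_exists subC.
have [B [freeB subB]] := sbc w.
exists (fun x => B x *m C x); split=> [x | a].
  by rewrite /row_free mxrankMfree // -/(row_free _).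
by rewrite -mulmxA vw mulmxA submxMr.
Qed.

(** Take a subrepresentation of dimension [b], then the preimage of one of dimension [r] in the
    quotient [w]. *)
Lemma gen_sub_add b c r d : (forall x, b x + c x = d x)%N ->
  gen_sub b d -> gen_sub r c -> gen_sub (fun x => b x + r x)%N d.
Proof.
move=> bcd sbd src_ v.
have [B [freeB subB]] := sbd v.
have /fin_all_exists[Bi /fin_all_exists[C /fin_all_exists[Ci splB]]] x :=
  row_free_split (freeB x) (bcd x).
pose w : mrep c := fun a => Ci (src a) *m v a *m C (tgt a).
have [R [freeR subR]] := src_ w.
exists (fun x => col_mx (B x) (R x *m Ci x)); split=> [x | a].
  have [BBi BC CiBi CiC tot] := splB x.
  have /row_freeP[Ri RRi] := freeR x.
  apply/row_freeP; exists (row_mx (Bi x) (C x *m Ri)).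
  rewrite mul_col_row BBi !mulmxA BC mul0mx -mulmxA CiBi mulmx0.
  by rewrite -[R x *m _ *m _]mulmxA CiC mulmx1 RRi -scalar_mx_block.
rewrite mul_col_mx col_mx_sub; apply/andP; split.
  by apply: submx_trans (subB a) _; rewrite -addsmxE addsmxSl.
have [D eD] := submxP (subR a).
rewrite -addsmxE.
(* The difference dies in the quotient, hence lies in the row space of [B (tgt a)]. *)
have -> : R (src a) *m Ci (src a) *m v a =
    (R (src a) *m Ci (src a) *m v a - D *m (R (tgt a) *m Ci (tgt a))) +
    D *m (R (tgt a) *m Ci (tgt a)) by rewrite subrK.
apply: addmx_sub_adds; last exact: submxMl.
apply/(split_mx_sub _ (splB (tgt a))).
have [BBi BC CiBi CiC tot] := splB (tgt a).
rewrite mulmxBl -!mulmxA CiC mulmx1 -eD /w !mulmxA.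
by rewrite subrr.
Qed.

End MatrixRepresentations.

(** * Translation between subspaces and matrices with independent rows *)

Section Transfer.

Variables (K : fieldType) (Q : quiver).

Lemma mulmx_linfunP m n (f : 'Hom('rV[K]_m, 'rV[K]_n)) :
  exists A : 'M_(m, n), forall u, f u = u *m A.
Proof. by exists (lin1_mx f) => u; rewrite mul_rV_lin1. Qed.

Lemma vspace_rowP m b (S : {vspace 'rV[K]_m}) : \dim S = b ->
  exists2 B : 'M[K]_(b, m), row_free B & forall u, (u \in S) = (u <= B)%MS.
Proof.
move=> dimS; subst b; pose B := \matrix_(i < \dim S) (vbasis S)`_i.
have mulB u : u *m B = \sum_(i < \dim S) u 0 i *: (vbasis S)`_i.
  by rewrite mulmx_sum_row; apply: eq_bigr => i _; rewrite rowK.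
have basS := vbasisP S.
exists B => [|u].
  rewrite -kermx_eq0; apply/eqP/row_matrixP => i; rewrite row0.
  set u := row i _; have uB : u *m B = 0.
    by apply/sub_kermxP/row_sub.
  have /freeP/(_ (u 0)) fr := basis_free basS.
  by apply/rowP => j; rewrite [RHS]mxE fr // -mulB.
apply/idP/submxP => [uS | [w ->]].
  exists (\row_i coord (vbasis S) i u).
  by rewrite mulB {1}(coord_vbasis uS); apply: eq_bigr => i _; rewrite mxE.
by rewrite mulB memv_suml // => i _; rewrite memvZ // vbasis_mem ?mem_nth ?size_tuple.
Qed.

Lemma row_vspaceP m b (B : 'M[K]_(b, m)) : row_free B ->
  exists2 S : {vspace 'rV[K]_m}, \dim S = b & forall u, (u \in S) = (u <= B)%MS.
Proof.
move=> freeB; pose X := [seq row i B | i <- enum 'I_b].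
have sX : size X == b by rewrite size_map size_enum_ord.
pose Xt := Tuple sX.
have nthX (i : 'I_b) : Xt`_i = row i B.
  by rewrite (nth_map i) ?size_enum_ord // nth_ord_enum.
have mulB (u : 'rV_b) : \sum_(i < b) u 0 i *: Xt`_i = u *m B.
  by rewrite mulmx_sum_row; apply: eq_bigr => i _; rewrite nthX.
have frX : free Xt.
  apply/freeP => k; have := mulB (\row_i k i).
  under eq_bigr do rewrite mxE.
  move=> -> kB i; have /rowP/(_ i) : (\row_i k i : 'rV[K]_b) = 0.
    by apply: (row_free_inj freeB); rewrite kB mul0mx.
  by rewrite !mxE.
exists <<Xt>>%VS; first by rewrite (eqP frX) size_tuple.
move=> u; apply/idP/submxP => [uX | [w ->]].
  exists (\row_i coord Xt i u); rewrite -mulB {1}(coord_span uX).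
  by apply: eq_bigr => i _; rewrite mxE.
by rewrite -mulB memv_suml // => i _; rewrite memvZ // memv_span ?mem_nth ?size_tuple.
Qed.

Lemma schofield_sub_gen (b d : dimvec Q) :
  schofield_sub K b d <-> gen_sub K b d.
Proof.
split=> [[le_bd sub_bd] v | sub_bd].
  have /fin_all_exists[f fP] a : exists f : 'Hom('rV[K]_(d (src a)), 'rV[K]_(d (tgt a))),
      forall u, f u = u *m v a.
    by exists (linfun (mulmxr (v a))) => u; rewrite lfunE.
  have [S [subS dimS]] := sub_bd f.
  have /fin_all_exists2[B freeB SB] x := vspace_rowP (dimS x).
  exists B; split=> // a; apply/row_subP => i; rewrite row_mul -SB -fP.
  by apply/(subvP (subS a))/memv_img; rewrite SB row_sub.
split=> [x | f]; first exact: gen_sub_le sub_bd.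
have /fin_all_exists[v vP] a := mulmx_linfunP (f a).
have [B [freeB subB]] := sub_bd v.
have /fin_all_exists2[S dimS SB] x := row_vspaceP (freeB x).
exists S; split=> // a; apply/subvP => _ /memv_imgP[u + ->].
by rewrite !SB vP => uB; apply: submx_trans (submxMr _ uB) (subB a).
Qed.

End Transfer.

(** * Counting polynomials *)

Section Counting.

Variable K : numFieldType.

Definition monom_fun (J : finType) (x : J -> K) (m : {ffun J -> nat}) : K :=
  \prod_j x j ^+ m j.

(** Polynomial functions of degree at most [E] in each variable separately: their exponents lie in a
    box, which is counted by a power of [E + 1]. *)
Definition box_poly (J : finType) (E : nat) (g : (J -> K) -> K) : Prop :=
  exists2 s : seq (K * {ffun J -> nat}),
    (forall m j, m \in s -> m.2 j <= E)%N
  & forall x, g x = \sum_(m <- s) m.1 * monom_fun x m.2.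

Lemma box_polyW (J : finType) E E' (g : (J -> K) -> K) :
  (E <= E')%N -> box_poly E g -> box_poly E' g.
Proof.
by move=> leE [s sE gE]; exists s => // m j /(sE _ j) /leq_trans ->.
Qed.

Lemma box_polyC (J : finType) E (a : K) : @box_poly J E (fun=> a).
Proof.
exists [:: (a, [ffun=> 0%N])] => [m j | x]; rewrite ?inE.
  by move/eqP->; rewrite ffunE.
rewrite big_seq1 /monom_fun big1 ?mulr1 // => j _.
by rewrite ffunE.
Qed.

Lemma box_polyX (J : finType) (j : J) : box_poly 1 (fun x => x j).
Proof.
exists [:: (1, [ffun i => (i == j) : nat])] => [m i | x]; rewrite ?inE.
  by move/eqP->; rewrite ffunE; case: eqP.
rewrite big_seq1 /monom_fun mul1r (bigD1 j) //= ffunE eqxx big1 ?mulr1 //.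
by move=> i /negPf ij; rewrite ffunE ij.
Qed.

Lemma box_polyD (J : finType) E (g h : (J -> K) -> K) :
  box_poly E g -> box_poly E h -> box_poly E (fun x => g x + h x).
Proof.
move=> [s sE gE] [r rE hE]; exists (s ++ r) => [m j | x].
  by rewrite mem_cat => /orP[/sE | /rE].
by rewrite big_cat gE hE.
Qed.

Lemma box_polyM (J : finType) E E' (g h : (J -> K) -> K) :
  box_poly E g -> box_poly E' h -> box_poly (E + E') (fun x => g x * h x).
Proof.
move=> [s sE gE] [r rE hE].
pose mon := (K * {ffun J -> nat})%type.
exists [seq (m.1 * k.1, [ffun j => m.2 j + k.2 j]%N) | m : mon <- s, k : mon <- r].
  move=> _ j /allpairsP[[m k] /= [ms kr ->]] /=.
  by rewrite ffunE leq_add ?sE ?rE.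
move=> x; rewrite gE hE big_allpairs_dep big_distrlr /=.
apply: eq_bigr => m _; apply: eq_bigr => k _; rewrite mulrACA; congr (_ * _).
by rewrite -big_split; apply: eq_bigr => j _; rewrite ffunE exprD.
Qed.

Lemma box_polyN (J : finType) E (g : (J -> K) -> K) :
  box_poly E g -> box_poly E (fun x => - g x).
Proof.
move=> /(box_polyM (@box_polyC J 0 (- 1))); rewrite add0n => -[s sE gE].
by exists s => // x; rewrite -gE mulN1r.
Qed.

Lemma box_poly_sum (J S : finType) E (g : S -> (J -> K) -> K) :
  (forall i, box_poly E (g i)) -> box_poly E (fun x => \sum_i g i x).
Proof.
move=> gE; elim: (index_enum S) => [|i r IHr].
  by case: (@box_polyC J E 0) => s sE s0; exists s => // x; rewrite big_nil; apply: s0.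
have [s sE sg] := box_polyD (gE i) IHr.
by exists s => // x; rewrite big_cons sg.
Qed.

Lemma box_poly_exp (J : finType) E k (g : (J -> K) -> K) :
  box_poly E g -> box_poly (k * E) (fun x => g x ^+ k).
Proof.
move=> gE; elim: k => [|k IHk]; first exact: box_polyC.
have [s sE sg] := box_polyM gE IHk.
by exists s => // x; rewrite exprS sg.
Qed.

Lemma box_poly_prod (J S : finType) E (g : S -> (J -> K) -> K) :
  (forall i, box_poly E (g i)) -> box_poly (#|S| * E) (fun x => \prod_i g i x).
Proof.
move=> gE; have -> : #|S| = size (index_enum S) by rewrite cardT enumT [index_enum S]unlock.
elim: (index_enum S) => [|i r IHr].
  by case: (@box_polyC J 0 1) => s sE s1; exists s => // x; rewrite big_nil; apply: s1.
have [s sE sg] := box_polyM (gE i) IHr.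
by exists s => // x; rewrite big_cons sg.
Qed.

Definition box_mx (L : finType) k m n (A : (L -> K) -> 'M[K]_(m, n)) : Prop :=
  forall i j, box_poly k (fun y => A y i j).

Lemma box_mxW (L : finType) k k' m n (F : (L -> K) -> 'M[K]_(m, n)) :
  (k <= k')%N -> box_mx k F -> box_mx k' F.
Proof. by move=> le_k HF i j; apply: box_polyW (HF i j). Qed.

Lemma box_mxM (L : finType) k k' m n r (F : (L -> K) -> 'M[K]_(m, n))
    (G : (L -> K) -> 'M[K]_(n, r)) :
  box_mx k F -> box_mx k' G -> box_mx (k + k') (fun y => F y *m G y).
Proof.
move=> HF HG i j.
have [s sP sE] := box_poly_sum (fun l => box_polyM (HF i l) (HG l j)).
by exists s => // y; rewrite mxE -sE.
Qed.

Lemma box_mxD (L : finType) k m n (F G : (L -> K) -> 'M[K]_(m, n)) :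
  box_mx k F -> box_mx k G -> box_mx k (fun y => F y + G y).
Proof.
move=> HF HG i j; have [s sP sE] := box_polyD (HF i j) (HG i j).
by exists s => // y; rewrite mxE -sE.
Qed.

Lemma box_mxN (L : finType) k m n (F : (L -> K) -> 'M[K]_(m, n)) :
  box_mx k F -> box_mx k (fun y => - F y).
Proof.
move=> HF i j; have [s sP sE] := box_polyN (HF i j).
by exists s => // y; rewrite mxE -sE.
Qed.

Lemma box_mx_var (L : finType) m n (f : 'I_m -> 'I_n -> L) :
  box_mx 1 (fun y : L -> K => \matrix_(i, j) y (f i j)).
Proof.
move=> i j; have [s sP sE] := box_polyX (f i j).
by exists s => // y; rewrite mxE -sE.
Qed.

Lemma box_mx_block (L : finType) k m1 m2 n1 n2
    (F : (L -> K) -> 'M[K]_(m1, n1)) (G : (L -> K) -> 'M[K]_(m1, n2))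
    (H : (L -> K) -> 'M[K]_(m2, n1)) (M : (L -> K) -> 'M[K]_(m2, n2)) :
  box_mx k F -> box_mx k G -> box_mx k H -> box_mx k M ->
  box_mx k (fun y => block_mx (F y) (G y) (H y) (M y)).
Proof.
move=> HF HG HH HM i j; rewrite -(splitK i) -(splitK j).
case: (split i) => i'; case: (split j) => j' /=;
  [have [s sP sE] := HF i' j' | have [s sP sE] := HG i' j'
  |have [s sP sE] := HH i' j' | have [s sP sE] := HM i' j'];
  by exists s => // y; rewrite ?(block_mxEul, block_mxEur, block_mxEdl, block_mxEdr).
Qed.

(** Terms with equal exponents are gathered; [inord] alters no exponent, since each is at most
    [E]. *)
Lemma box_poly_coef (J : finType) E (g : (J -> K) -> K) : box_poly E g ->
  exists c : {ffun J -> 'I_E.+1} -> K,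
    forall x, g x = \sum_m c m * \prod_j x j ^+ m j.
Proof.
move=> [s sE gE].
exists (fun m => \sum_(k <- s | [ffun j => inord (k.2 j)] == m) k.1) => x.
rewrite gE; under [RHS]eq_bigr do rewrite big_distrl /=.
rewrite (exchange_big_dep xpredT) //= big_seq_cond [RHS]big_seq_cond.
apply: eq_bigr => k /andP[ks _].
rewrite (eq_bigl (pred1 [ffun j => inord (k.2 j)])); last by move=> m; apply: eq_sym.
rewrite big_pred1_eq; congr (_ * _); apply: eq_bigr => j _.
by rewrite ffunE inordK // ltnS sE.
Qed.

Lemma base_expansion_inj D n (f g : 'I_n -> 'I_D) :
  (\sum_(i < n) f i * D ^ i = \sum_(i < n) g i * D ^ i)%N -> f =1 g.
Proof.
elim: n f g => [|n IHn] f g; first by move=> _ [].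
have [D0 | Dgt0] := posnP D; first by move=> _ i; have := ltn_ord (f i); rewrite {2}D0.
have recl (h : 'I_n.+1 -> 'I_D) : (\sum_(i < n.+1) h i * D ^ i =
    (\sum_(i < n) h (lift ord0 i) * D ^ i) * D + h ord0)%N.
  rewrite big_ord_recl expn0 muln1 addnC big_distrl; congr (_ + _)%N.
  by apply: eq_bigr => i _; rewrite /= expnSr mulnA.
rewrite !recl => fg.
have eq0 : f ord0 = g ord0.
  apply/val_inj; have := congr1 (modn^~ D) fg.
  by rewrite !modnMDl !modn_small.
have /IHn eqS : (\sum_(i < n) f (lift ord0 i) * D ^ i =
                 \sum_(i < n) g (lift ord0 i) * D ^ i)%N.
  by apply/eqP; rewrite -(eqn_pmul2r Dgt0) -(eqn_add2r (g ord0)) -{1}eq0 fg.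
by move=> i; case: (unliftP ord0 i) => [j ->|->].
Qed.

(** The number whose base [D] digits are the values of [f], in the order of [enum_rank]. *)
Definition kronecker (I : finType) D (f : {ffun I -> 'I_D}) : nat :=
  (\sum_i f i * D ^ enum_rank i)%N.

Lemma kronecker_inj (I : finType) D : injective (@kronecker I D).
Proof.
have kE (f : {ffun I -> 'I_D}) :
    kronecker f = (\sum_(k < #|I|) f (enum_val k) * D ^ k)%N.
  rewrite /kronecker (reindex (@enum_val I predT)) /=; last first.
    by apply: onW_bij; apply: enum_val_bij.
  by apply: eq_bigr => k _; rewrite enum_valK.
move=> f g; rewrite !kE => /base_expansion_inj fg; apply/ffunP => i.
by rewrite -(enum_rankK i).
Qed.

(* The substitution [x_i := t ^ (D ^ i)] keeps distinct monomials of a box of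
   size [D] distinct. *)
Lemma box_poly_nonvanishing (I : finType) D (w : {ffun I -> 'I_D} -> K) f0 :
  w f0 != 0 -> exists x : I -> K, \sum_f w f * \prod_i x i ^+ f i != 0.
Proof.
move=> wf0; pose p := \sum_f (w f)%:P * 'X^(kronecker f).
have p0 : p != 0.
  apply/eqP => /(congr1 (fun q : {poly K} => q`_(kronecker f0))).
  rewrite coef0 coef_sum (bigD1 f0) //= coefCM coefXn eqxx mulr1 big1.
    by move/eqP; rewrite addr0 (negPf wf0).
  move=> f nff0; rewrite coefCM coefXn eq_sym.
  by rewrite (negPf (contra_neq (@kronecker_inj _ _ _ _) nff0)) mulr0.
have [t pt] := cofin_ex (cofin_poly p0).
exists (fun i => t ^+ (D ^ enum_rank i)).
apply: contraNneq pt => <-; rewrite horner_sum; apply/eqP/eq_bigr => f _.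
rewrite hornerCM hornerXn; congr (_ * _).
under [RHS]eq_bigr => i _ do rewrite -exprM mulnC.
by rewrite prodrXr.
Qed.

(** Pull back to all the sources the monomials in the target coordinates with exponents below [D].
    For large [D] they outnumber the available coefficients, so a nontrivial combination vanishes on
    all the images; a point off this hypersurface is missed. *)
Lemma poly_maps_not_covering (I J T : finType) E (p : T -> (J -> K) -> I -> K) :
    (forall t i, box_poly E (fun y => p t y i)) -> (#|J| < #|I|)%N ->
  exists x : I -> K, forall t y, ~ (p t y =1 x).
Proof.
move=> pE ltJI.
(* Pullbacks have degree at most [B] and [B + 1 <= e D], so there are at most [#|T| e^#|J| D^#|J|]
   coefficients; this is less than [D^(#|J| + 1)], hence than [D^#|I|]. *)
pose e := (#|I| * E).+1; pose D := (#|T| * e ^ #|J|).+1.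
pose B := (#|I| * (D * E))%N.
pose M : finType := {ffun I -> 'I_D}.
pose N : finType := (T * {ffun J -> 'I_B.+1})%type.
have hB (f : M) t : box_poly B (fun y => \prod_i p t y i ^+ f i).
  apply: box_poly_prod => i; apply: (@box_polyW _ (f i * E)).
    by rewrite leq_mul2r ltnW ?orbT.
  exact: box_poly_exp.
have /fin_all_exists[c cP] (f : M) := fin_all_exists (fun t => box_poly_coef (hB f t)).
pose A : 'M[K]_(#|M|, #|N|) :=
  \matrix_(i, j) c (enum_val i) (enum_val j).1 (enum_val j).2.
have ltNM : (#|N| < #|M|)%N.
  rewrite card_prod !card_ffun !card_ord.
  have leB : (B.+1 <= e * D)%N.
    by rewrite /B /e mulSn -[X in (X <= _)%N]add1n mulnCA (mulnC D) leq_add2r.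
  apply: (@leq_ltn_trans (#|T| * (e * D) ^ #|J|)).
    by rewrite leq_mul2l; case: #|J| => [|k]; rewrite ?expn0 ?orbT // leq_exp2r ?leB ?orbT.
  rewrite expnMn mulnA; apply: (@leq_trans (D ^ #|J|.+1)).
    by rewrite expnS ltn_pmul2r ?expn_gt0.
  by rewrite leq_pexp2l.
(* A left kernel vector of the coefficient matrix is the equation of the hypersurface. *)
have [w wA w0] : exists2 w : 'rV_#|M|, w *m A = 0 & w != 0.
  have : kermx A != 0.
    rewrite kermx_eq0 /row_free neq_ltn (leq_ltn_trans (rank_leq_col _)) //.
  by case/rowV0Pn => w /sub_kermxP; exists w.
have [k wk] : exists k, w 0 k != 0.
  by apply/existsP; apply: contra_neqT w0; rewrite negb_exists => /forallP w0;
     apply/rowP => k; rewrite [RHS]mxE; apply/eqP/negPn.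
have [x xP] := @box_poly_nonvanishing _ _ (fun f : M => w 0 (enum_rank f))
  (enum_val k) (eq_ind_r (fun i => w 0 i != 0) wk (enum_valK k)).
exists x => t y pyx; case/eqP: xP.
transitivity (\sum_(i < #|M|) \sum_m
    w 0 i * c (enum_val i) t m * \prod_j y j ^+ m j).
  rewrite [LHS](reindex (@enum_val M predT)) /=; last first.
    by apply: onW_bij; apply: enum_val_bij.
  apply: eq_bigr => i _; rewrite enum_valK.
  under eq_bigr do rewrite -pyx.
  by rewrite cP big_distrr; apply: eq_bigr => m _; rewrite /= mulrA.
rewrite exchange_big big1 // => m _; rewrite -big_distrl /=.
have /rowP/(_ (enum_rank (t, m))) := wA; rewrite /A !mxE => wA0.
rewrite [X in X * _](_ : _ = 0) ?mul0r // -[RHS]wA0.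
by apply: eq_bigr => i _; rewrite mxE enum_rankK.
Qed.

End Counting.

(** * Necessity of the inequalities *)

Section Necessity.

Lemma perm_extension b c (f : 'I_b -> 'I_(b + c)) : injective f ->
  exists s : 'S_(b + c), forall i, s (lshift c i) = f i.
Proof.
move=> f_inj; pose r := codom f ++ enum [predC codom f].
have sz_f : size (codom f) = b by rewrite size_codom card_ord.
have uniq_r : uniq r.
  rewrite cat_uniq enum_uniq andbT map_inj_uniq // enum_uniq /=.
  by apply/hasPn => i; rewrite mem_enum.
have sz_r : size r = (b + c)%N.
  rewrite size_cat sz_f -cardE; congr (_ + _)%N.
  have := cardC (mem (codom f)); rewrite card_codom // !card_ord.
  by move/eqP; rewrite eqn_add2l => /eqP.
have r_inj : injective (fun i : 'I_(b + c) => nth i r i).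
  move=> i j; rewrite (set_nth_default j) ?sz_r // => /eqP.
  by rewrite nth_uniq ?sz_r // => /eqP/val_inj.
exists (perm r_inj) => i; rewrite permE nth_cat sz_f /= ltn_ord.
by rewrite (nth_map i) ?size_enum_ord // nth_ord_enum.
Qed.

Variable K : numFieldType.

(** The standard charts of the Grassmannian: [s] brings a nonzero maximal minor to the front, and
    dividing by it makes the row space a graph. *)
Lemma row_free_graph b c (B : 'M[K]_(b, b + c)) : row_free B ->
  exists (s : 'S_(b + c)) (E : 'M_(b, c)), (col_perm s B :=: row_mx 1%:M E)%MS.
Proof.
move=> freeB; have fullBT : row_full B^T by rewrite /row_full mxrank_tr.
pose f := fullrankfun fullBT.
have [s sf] := perm_extension (@fullrankfun_inj _ _ _ _ fullBT : injective f).
have uB : lsubmx (col_perm s B) \in unitmx.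
  rewrite -unitmx_tr -row_free_unit /row_free.
  rewrite (_ : _^T = rowsub f B^T) ?mxrank_fullrowsub //.
  by apply/matrixP => i j; rewrite !mxE sf.
exists s, (invmx (lsubmx (col_perm s B)) *m rsubmx (col_perm s B)).
rewrite -[X in row_mx X](mulVmx uB) -mul_mx_row hsubmxK.
by apply/eqmx_sym/eqmxMfull; rewrite row_full_unit unitmx_inv.
Qed.

(** The left block determines the factor of the inclusion; the right block is then the stated
    equation. *)
Lemma graph_stable b1 c1 b2 c2 (v : 'M[K]_(b1 + c1, b2 + c2)) E1 E2 :
  (row_mx 1%:M E1 *m v <= row_mx 1%:M E2)%MS <->
  ursubmx v + E1 *m drsubmx v = (ulsubmx v + E1 *m dlsubmx v) *m E2.
Proof.
rewrite -{1}[v]submxK mul_row_block !mul1mx; split=> [/submxP[D]|->].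
  by rewrite mul_mx_row mulmx1 => /eq_row_mx[-> ->].
by rewrite -[X in row_mx X _]mulmx1 -mul_mx_row submxMl.
Qed.

Variable Q : quiver.

Section Counts.

Variables b c : vertex Q -> nat.

(** Parameters of the pairs (representation, subrepresentation): [T] selects a chart at each vertex,
    [JE] holds the graph coordinates, and [JA], [JC], [JD] hold three blocks of the representation.
    [I] indexes its entries. *)
Let T : finType := {dffun forall x : vertex Q, 'S_(b x + c x)}.
Let JE : finType := {x : vertex Q & 'I_(b x) * 'I_(c x)}%type.
Let JA : finType := {a : arrow Q & 'I_(b (src a)) * 'I_(b (tgt a))}%type.
Let JC : finType := {a : arrow Q & 'I_(c (src a)) * 'I_(b (tgt a))}%type.
Let JD : finType := {a : arrow Q & 'I_(c (src a)) * 'I_(c (tgt a))}%type.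
Let J : finType := (JE + (JA + (JC + JD)))%type.
Let I : finType := {a : arrow Q &
  'I_(b (src a) + c (src a)) * 'I_(b (tgt a) + c (tgt a))}%type.

Let E (y : J -> K) x : 'M_(b x, c x) :=
  \matrix_(i, j) y (inl (Tagged (fun x => 'I_(b x) * 'I_(c x))%type (i, j))).
Let A (y : J -> K) a : 'M_(b (src a), b (tgt a)) :=
  \matrix_(i, j) y (inr (inl (Tagged
    (fun a : arrow Q => 'I_(b (src a)) * 'I_(b (tgt a)))%type (i, j)))).
Let C (y : J -> K) a : 'M_(c (src a), b (tgt a)) :=
  \matrix_(i, j) y (inr (inr (inl (Tagged
    (fun a : arrow Q => 'I_(c (src a)) * 'I_(b (tgt a)))%type (i, j))))).
Let D (y : J -> K) a : 'M_(c (src a), c (tgt a)) :=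
  \matrix_(i, j) y (inr (inr (inr (Tagged
    (fun a : arrow Q => 'I_(c (src a)) * 'I_(c (tgt a)))%type (i, j))))).

(** The upper right block is the solution of the equation in [graph_stable], so that the graphs of
    [E y] form a subrepresentation. *)
Let W y a := block_mx (A y a)
  ((A y a + E y (src a) *m C y a) *m E y (tgt a) - E y (src a) *m D y a)
  (C y a) (D y a).

Let p (t : T) (y : J -> K) (i : I) : K :=
  W y (tag i) ((t (src (tag i)))^-1%g (tagged i).1)
              ((t (tgt (tag i)))^-1%g (tagged i).2).

(** The numbers [#|I|] and [#|J|] differ by the two sums compared here. If the inequality failed,
    the finitely many maps [p t] could not reach every representation. *)
Lemma gen_sub_count : gen_sub K b (fun x => b x + c x)%N ->
  (\sum_a b (src a) * c (tgt a) <= \sum_x b x * c x)%N.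
Proof.
move=> sub; rewrite leqNgt; apply/negP => lt_dim.
have pE t i : box_poly 3 (fun y => p t y i).
  apply: box_mx_block.
  - exact: box_mxW (box_mx_var _ _).
  - apply: box_mxD; last first.
      by apply/box_mxN/(@box_mxW K _ 2)=> //; apply: (box_mxM (k := 1)); apply: box_mx_var.
    apply: (box_mxM (k := 2)); last exact: box_mx_var.
    apply: box_mxD; first exact: box_mxW (box_mx_var _ _).
    by apply: (box_mxM (k := 1)); apply: box_mx_var.
  - exact: box_mxW (box_mx_var _ _).
  - exact: box_mxW (box_mx_var _ _).
have cardS (S : finType) (m n : S -> nat) :
    #|{: {x : S & 'I_(m x) * 'I_(n x)}%type}| = (\sum_x m x * n x)%N.
  by rewrite card_tagged sumnE big_map big_enum /=; apply: eq_bigr => x _;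
     rewrite card_prod !card_ord.
have ltJI : (#|J| < #|I|)%N.
  rewrite /J !card_sum !cardS.
  under [X in (_ < X)%N]eq_bigr do rewrite mulnDl !mulnDr.
  rewrite !big_split /=.
  by rewrite -[X in (_ < X)%N]addnA [X in (_ < X)%N]addnCA ltn_add2r.
have [x xP] := poly_maps_not_covering pE ltJI.
pose v : mrep K (fun x => b x + c x)%N := fun a =>
  \matrix_(i, j) x (Tagged (fun a : arrow Q =>
     'I_(b (src a) + c (src a)) * 'I_(b (tgt a) + c (tgt a)))%type (i, j)).
have [B [freeB subB]] := sub v.
have /fin_all_exists[s /fin_all_exists[F FP]] z := row_free_graph (freeB z).
pose v' a := col_perm (s (tgt a)) (row_perm (s (src a)) (v a)).
pose y (j : J) : K := match j with
  | inl k => F (tag k) (tagged k).1 (tagged k).2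
  | inr (inl k) => ulsubmx (v' (tag k)) (tagged k).1 (tagged k).2
  | inr (inr (inl k)) => dlsubmx (v' (tag k)) (tagged k).1 (tagged k).2
  | inr (inr (inr k)) => drsubmx (v' (tag k)) (tagged k).1 (tagged k).2
  end.
have [yE yA yC yD] : [/\ forall z, E y z = F z, forall a, A y a = ulsubmx (v' a),
    forall a, C y a = dlsubmx (v' a) & forall a, D y a = drsubmx (v' a)].
  by split=> z; apply/matrixP => i j; rewrite mxE.
have Wy a : W y a = v' a.
  have /graph_stable Ev : (row_mx 1%:M (F (src a)) *m v' a <= row_mx 1%:M (F (tgt a)))%MS.
    rewrite -(eqmxMr _ (FP (src a))) -FP /v' mul_col_perm col_row_permC.
    rewrite -row_permM mulVg row_perm1 !col_permE mulmxA.
    exact: submxMr.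
  by rewrite /W !yE yA yC yD -Ev addrK submxK.
apply: (xP (finfun s) y) => -[a [i j]].
by rewrite /p /= Wy !mxE !ffunE !permKV.
Qed.
End Counts.
End Necessity.

(** * Homomorphisms and extensions *)

Section Families.

Variables (T : finType) (m n : T -> nat).

(** Families of matrices are flattened into row vectors, so that linear maps between them have
    matrices and ranks. *)
Definition hidx : finType := {t : T & 'I_(m t) * 'I_(n t)}%type.

Lemma card_hidx : #|hidx| = (\sum_t m t * n t)%N.
Proof.
rewrite card_tagged sumnE big_map big_enum /=.
by apply: eq_bigr => t _; rewrite card_prod !card_ord.
Qed.

Definition hvec (R : Type) (F : forall t, 'M[R]_(m t, n t)) : 'rV[R]_#|hidx| :=
  \row_k F (tag (enum_val k)) (tagged (enum_val k)).1 (tagged (enum_val k)).2.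

Definition hmat (R : Type) (u : 'rV[R]_#|hidx|) (t : T) : 'M[R]_(m t, n t) :=
  \matrix_(i, j)
    u 0 (enum_rank (Tagged (fun t => 'I_(m t) * 'I_(n t))%type (i, j))).

Lemma hvecK (R : Type) (F : forall t, 'M[R]_(m t, n t)) t : hmat (hvec F) t = F t.
Proof. by apply/matrixP => i j; rewrite !mxE enum_rankK. Qed.

Lemma hmatK (R : Type) (u : 'rV[R]_#|hidx|) : hvec (hmat u) = u.
Proof.
apply/rowP => k; rewrite !mxE; congr (u 0 _); rewrite -[RHS]enum_valK.
by congr enum_rank; case: (enum_val k) => t [i j].
Qed.

Lemma eq_hvec (R : Type) (F G : forall t, 'M[R]_(m t, n t)) :
  (forall t, F t = G t) -> hvec F = hvec G.
Proof. by move=> FG; apply/rowP => k; rewrite !mxE FG. Qed.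

Lemma hmatP (R : nzRingType) a (u v : 'rV[R]_#|hidx|) t :
  hmat (a *: u + v) t = a *: hmat u t + hmat v t.
Proof. by apply/matrixP => i j; rewrite !mxE. Qed.

Lemma hvecP (R : nzRingType) a (F G : forall t, 'M[R]_(m t, n t)) :
  hvec (fun t => a *: F t + G t) = a *: hvec F + hvec G.
Proof. by apply/rowP => k; rewrite !mxE. Qed.

Lemma hvec_eq0 (R : nzRingType) (F : forall t, 'M[R]_(m t, n t)) :
  hvec F = 0 -> forall t, F t = 0.
Proof. by move=> F0 t; rewrite -hvecK F0; apply/matrixP => i j; rewrite !mxE. Qed.

Lemma hvec0 (R : nzRingType) (F : forall t, 'M[R]_(m t, n t)) :
  (forall t, F t = 0) -> hvec F = 0.
Proof. by move=> F0; apply/rowP => k; rewrite !mxE F0 mxE. Qed.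

End Families.

Section HomExt.

Variables (K : fieldType) (Q : quiver) (c d : vertex Q -> nat).
Implicit Types (V : mrep K c) (W : mrep K d).

(* The kernel of this map is Hom(V, W) and its cokernel is Ext(V, W). *)
Definition hom_diff V W (f : forall x, 'M[K]_(c x, d x)) (a : arrow Q) :
    'M[K]_(c (src a), d (tgt a)) :=
  f (src a) *m W a - V a *m f (tgt a).

Definition hom_zero V W : Prop :=
  forall f, (forall a, hom_diff V W f a = 0) -> forall x, f x = 0.

Definition ext_zero V W : Prop :=
  forall g : (forall a : arrow Q, 'M[K]_(c (src a), d (tgt a))),
  exists f, forall a, hom_diff V W f a = g a.

Lemma hom_diffP V W a f g e :
  hom_diff V W (fun x => a *: f x + g x) e = a *: hom_diff V W f e + hom_diff V W g e.
Proof.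
rewrite /hom_diff mulmxDl mulmxDr -scalemxAl -scalemxAr scalerBr.
by rewrite opprD addrACA.
Qed.

Lemma eq_hom_diff V W f g : (forall x, f x = g x) ->
  forall a, hom_diff V W f a = hom_diff V W g a.
Proof. by move=> fg a; rewrite /hom_diff !fg. Qed.

Let hd V W (u : 'rV[K]_#|hidx c d|) :
    'rV[K]_#|@hidx (arrow Q) (c \o @src Q) (d \o @tgt Q)| :=
  @hvec (arrow Q) (c \o @src Q) (d \o @tgt Q) K (hom_diff V W (hmat u)).

Let hd_linear V W : linear (hd V W).
Proof.
move=> a u v; rewrite /hd -hvecP; apply: eq_hvec => e /=.
by rewrite -hom_diffP; apply: eq_hom_diff => x; rewrite hmatP.
Qed.

Definition hom_diff_mx V W :
    'M[K]_(#|hidx c d|, #|@hidx (arrow Q) (c \o @src Q) (d \o @tgt Q)|) :=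
  lin1_mx (hd V W).

Lemma mul_hom_diff_mx V W u : u *m hom_diff_mx V W =
  @hvec (arrow Q) (c \o @src Q) (d \o @tgt Q) K (hom_diff V W (hmat u)).
Proof.
pose hL : {linear _ -> _} :=
  HB.pack (hd V W) (GRing.isLinear.Build K _ _ *:%R (hd V W) (hd_linear V W)).
exact: (mul_rV_lin1 hL).
Qed.

Lemma mul_hom_diff_mx_eq0 V W u :
  u *m hom_diff_mx V W = 0 <-> forall a, hom_diff V W (hmat u) a = 0.
Proof.
rewrite mul_hom_diff_mx; split=> [/hvec_eq0 // | u0].
by apply: hvec0 => a; apply: u0.
Qed.

Lemma hom_zero_free V W : hom_zero V W <-> row_free (hom_diff_mx V W).
Proof.
split=> [homVW | free_hd f f0 x].
  rewrite -kermx_eq0; apply/eqP/row_matrixP => i; rewrite row0.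
  have /sub_kermxP/mul_hom_diff_mx_eq0/homVW u0 := row_sub i (kermx (hom_diff_mx V W)).
  by rewrite -[LHS]hmatK; apply: hvec0.
apply: (@hvec_eq0 _ c d); apply: (row_free_inj free_hd); rewrite mul0mx.
apply/mul_hom_diff_mx_eq0 => a; rewrite -[RHS](f0 a).
by apply: eq_hom_diff => y; rewrite hvecK.
Qed.

Lemma ext_zero_full V W : ext_zero V W <-> row_full (hom_diff_mx V W).
Proof.
split=> [extVW | /row_fullP[X XM] g].
  apply/row_fullP; suff /fin_all_exists[u uM] i :
      exists u : 'rV_ _, u *m hom_diff_mx V W = row i 1%:M.
    exists (\matrix_i u i); apply/row_matrixP => i.
    by rewrite row_mul rowK uM.
  have [f fE] := extVW (@hmat _ (c \o @src Q) (d \o @tgt Q) _ (row i 1%:M)).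
  exists (hvec f); rewrite mul_hom_diff_mx -[RHS]hmatK; apply: eq_hvec => a.
  by rewrite -fE; apply: eq_hom_diff => x; rewrite hvecK.
pose v := @hvec (arrow Q) (c \o @src Q) (d \o @tgt Q) _ g.
exists (hmat (v *m X)) => a.
rewrite -[RHS](@hvecK (arrow Q) (c \o @src Q) (d \o @tgt Q)) -/v.
rewrite -[v in RHS]mulmx1 -XM mulmxA mul_hom_diff_mx.
by rewrite (@hvecK (arrow Q) (c \o @src Q) (d \o @tgt Q)).
Qed.

Let card_arrow : #|@hidx (arrow Q) (c \o @src Q) (d \o @tgt Q)| =
  (\sum_a c (src a) * d (tgt a))%N.
Proof. exact: card_hidx. Qed.

Lemma hom_zero_dim V W : hom_zero V W ->
  (\sum_x c x * d x <= \sum_a c (src a) * d (tgt a))%N.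
Proof.
move=> /hom_zero_free/eqP; rewrite -(card_hidx c d) => <-.
by rewrite -card_arrow rank_leq_col.
Qed.

Lemma ext_zero_dim V W : ext_zero V W ->
  (\sum_a c (src a) * d (tgt a) <= \sum_x c x * d x)%N.
Proof.
move=> /ext_zero_full/eqP; rewrite -(card_hidx c d).
by rewrite -card_arrow => <-; rewrite rank_leq_row.
Qed.

Lemma hom_zero_dim_eq V W : hom_zero V W ->
  (\sum_x c x * d x = \sum_a c (src a) * d (tgt a))%N -> ext_zero V W.
Proof.
move=> /hom_zero_free/eqP rk eq_dim; apply/ext_zero_full.
by rewrite /row_full rk card_hidx eq_dim -card_arrow.
Qed.

End HomExt.

(** * Kernels, images and cokernels of homomorphisms *)

Section Kernels.

Variables (K : fieldType) (Q : quiver) (c d : vertex Q -> nat).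

(** [S] spans the kernel, [I] the image, and [C] projects to the cokernel. The splitting at the
    source is the transpose of one for [(col_base f)^T]. *)
Lemma rank_factorization m n r (f : 'M[K]_(m, n)) : \rank f = r ->
  exists S Si P Pi I Ii C Ci,
    [/\ @split_mx K (m - r) r m S Si P Pi,
        @split_mx K r (n - r) n I Ii C Ci & f = P *m I].
Proof.
move=> <-.
have freeP : row_free (col_base f)^T.
  by rewrite /row_free mxrank_tr; apply/eqP/eqP/col_base_full.
have [Bi [C [Ci [h1 h2 h3 h4 h5]]]] := row_free_split freeP (subnKC (rank_leq_row f)).
have [Ii [D [Di splI]]] :=
  row_free_split (row_base_free f) (subnKC (rank_leq_col f)).
exists C^T, Ci^T, (col_base f), Bi^T, (row_base f), Ii, D, Di.
split=> //; last by rewrite mulmx_base.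
have tr p q s (X : 'M[K]_(p, q)) (Y : 'M_(q, s)) Z :
  X *m Y = Z -> Y^T *m X^T = Z^T by move=> <-; rewrite trmx_mul.
split; first by rewrite (tr _ _ _ _ _ _ h4) trmx1.
- by rewrite -[col_base f]trmxK (tr _ _ _ _ _ _ h2) trmx0.
- by rewrite (tr _ _ _ _ _ _ h3) trmx0.
- by rewrite -[col_base f]trmxK (tr _ _ _ _ _ _ h1) trmx1.
by rewrite -[col_base f]trmxK -!trmx_mul -linearD /= addrC h5 trmx1.
Qed.

(** These are the kernel and the image of [f]. *)
Lemma hom_has_sub (r : vertex Q -> nat) (V : mrep K c) (W : mrep K d)
    (f : forall x, 'M[K]_(c x, d x)) :
    (forall x, \rank (f x) = r x) -> (forall a, hom_diff V W f a = 0) ->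
  has_sub (fun x => c x - r x)%N V /\ has_sub r W.
Proof.
move=> rkf f0.
have /fin_all_exists[S /fin_all_exists[Si /fin_all_exists[P /fin_all_exists[Pi
  /fin_all_exists[I /fin_all_exists[Ii /fin_all_exists[C /fin_all_exists[Ci
  splf]]]]]]]] x := rank_factorization (rkf x).
have fVW a : f (src a) *m W a = V a *m f (tgt a) by apply/eqP; rewrite -subr_eq0 -f0.
split.
  exists S; split=> [x | a]; first by case: (splf x) => /split_mx_free.
  have [[_ SP _ _ _] _ fPI] := splf (src a).
  have [splS [IIi _ _ _ _] fPI'] := splf (tgt a).
  apply/(split_mx_sub _ splS); rewrite -[_ *m P _]mulmx1 -IIi !mulmxA.
  rewrite -(mulmxA _ (P _)) -fPI' -(mulmxA (S _)) -fVW fPI.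
  by rewrite !mulmxA SP !mul0mx.
exists I; split=> [x | a]; first by case: (splf x) => _ /split_mx_free.
have [[_ _ _ PiP _] _ fPI] := splf (src a).
have [_ _ fPI'] := splf (tgt a).
rewrite -[I _]mul1mx -PiP -!mulmxA (mulmxA (P _)) -fPI fVW fPI'.
by rewrite !mulmxA submxMl.
Qed.

(* The maps [g] with [S g C = 0] are those sending [ker f1] into [im f2]. *)
Lemma deformation_solve m n m' n' r r' (f1 : 'M[K]_(m, n)) (f2 : 'M[K]_(m', n'))
    S Si P Pi I Ii S2 Si2 P2 Pi2 I2 Ii2 C2 Ci2 C Ci (g : 'M[K]_(m, n')) :
    @split_mx K (m - r) r m S Si P Pi -> @split_mx K r (n - r) n I Ii C Ci ->
    @split_mx K (m' - r') r' m' S2 Si2 P2 Pi2 ->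
    @split_mx K r' (n' - r') n' I2 Ii2 C2 Ci2 ->
    f1 = P *m I -> f2 = P2 *m I2 -> S *m g *m C2 = 0 ->
  exists (V : 'M_(m, m')) (W : 'M_(n, n')), f1 *m W - V *m f2 = g.
Proof.
move=> [_ _ _ _ tot] [IIi _ _ _ _] [_ _ _ PiP _] [_ _ _ _ tot2] -> -> SgC.
exists (- (Si *m S *m g *m Ii2 *m Pi2)), (Ii *m Pi *m g).
rewrite mulNmx opprK !mulmxA -(mulmxA P) IIi mulmx1.
rewrite -(mulmxA _ Pi2) PiP mulmx1 -(mulmxA _ Ii2).
have -> : Si *m S *m g *m (Ii2 *m I2) = Si *m S *m g.
  rewrite -[RHS]mulmx1 -tot2 mulmxDr; have -> : Si *m S *m g *m (C2 *m Ci2) = 0.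
    by rewrite mulmxA -(mulmxA Si) -(mulmxA Si) SgC mulmx0 mul0mx.
  by rewrite addr0.
by rewrite -mulmxDl addrC tot mul1mx.
Qed.

End Kernels.

(** * Generic homomorphisms *)

Lemma exists_max (T : Type) (P : T -> Prop) (f : T -> nat) (N : nat) :
    (exists x, P x) -> (forall x, P x -> f x <= N)%N ->
  exists2 x, P x & forall y, P y -> (f y <= f x)%N.
Proof.
move=> [x0 Px0] fN; pose E n := `[< exists2 x, P x & f x = n >].
have exE : exists n, E n by exists (f x0); apply/asboolP; exists x0.
have ubE n : E n -> (n <= N)%N by move=> /asboolP[x /fN fx <-].
case: (ex_maxnP exE ubE) => _ /asboolP[x Px <-] max_x.
by exists x => // y Py; apply: max_x; apply/asboolP; exists y.
Qed.

Section GenericHom.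

Variables (K : numFieldType) (Q : quiver).

(* The existence of a subrepresentation of dimension [b] is a closed condition,
   tested along the lines [v + w / t] with [t] tending to infinity. *)
Definition sub_closed : Prop :=
  forall (b d : vertex Q -> nat) (v w : mrep K d),
  cofin (fun t => has_sub b (fun a => w a + t *: v a)) -> has_sub b v.

Hypothesis closed_sub : sub_closed.

Variables c d : vertex Q -> nat.

Let line (n : vertex Q -> nat) (V V' : mrep K n) t : mrep K n :=
  fun a => V a + t *: V' a.

Lemma hom_diff_line (V V' : mrep K c) (W W' : mrep K d) f t a :
  hom_diff (line V V' t) (line W W' t) f a =
  hom_diff V W f a + t *: hom_diff V' W' f a.
Proof.
rewrite /hom_diff /line mulmxDr mulmxDl -scalemxAr -scalemxAl scalerBr.
by rewrite opprD addrACA.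
Qed.

Lemma hom_diff_mx_line (V V' : mrep K c) (W W' : mrep K d) t :
  hom_diff_mx (line V V' t) (line W W' t) =
  hom_diff_mx V W + t *: hom_diff_mx V' W'.
Proof.
apply/row_matrixP => i; rewrite !rowE mulmxDr -scalemxAr !mul_hom_diff_mx.
rewrite addrC -hvecP; apply: eq_hvec => a.
by rewrite hom_diff_line addrC.
Qed.

(** The matrix of [hom_diff] is affine in [t] and its rank never exceeds the one at 0, so
    [kernel_curve] extends [f] to a polynomial family of homomorphisms. *)
Lemma hom_curve (V V' : mrep K c) (W W' : mrep K d) f :
    (forall t, \rank (hom_diff_mx (line V V' t) (line W W' t)) <=
               \rank (hom_diff_mx V W))%N ->
    (forall a, hom_diff V W f a = 0) ->
  exists2 F : forall x, 'M[{poly K}]_(c x, d x), forall x, mxev 0 (F x) = f x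
    & forall t a, hom_diff (line V V' t) (line W W' t) (fun x => mxev t (F x)) a = 0.
Proof.
move=> rk_max f0; pose M := mxC (hom_diff_mx V W) + 'X *: mxC (hom_diff_mx V' W').
have evM t : mxev t M = hom_diff_mx (line V V' t) (line W W' t).
  by rewrite mxevD mxevZ hornerX !mxevC hom_diff_mx_line.
have evM0 : mxev 0 M = hom_diff_mx V W.
  by rewrite mxevD mxevZ hornerX !mxevC scale0r addr0.
have fM : hvec f *m mxev 0 M = 0.
  rewrite evM0; apply/mul_hom_diff_mx_eq0 => a; rewrite -[RHS](f0 a).
  by apply: eq_hom_diff => x; rewrite hvecK.
have rkM : cofin (fun t => \rank (mxev t M) <= \rank (mxev 0 M))%N.
  by apply: cofinT => t; rewrite evM evM0.
have [U U0 UM] := kernel_curve rkM fM.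
have evU t x : mxev t (hmat U x) = hmat (mxev t U) x.
  by apply/matrixP => i j; rewrite !mxE.
exists (hmat U) => [x | t a]; first by rewrite evU U0 hvecK.
rewrite (eq_hom_diff _ _ (evU t)).
have /mul_hom_diff_mx_eq0 : mxev t U *m hom_diff_mx (line V V' t) (line W W' t) = 0.
  by rewrite -evM -mxevM UM mxev0.
exact.
Qed.

(** Differentiate at 0 the identity saying that [F] is a homomorphism along the line. *)
Lemma hom_curve_tangent (V V' : mrep K c) (W W' : mrep K d)
    (F : forall x, 'M[{poly K}]_(c x, d x)) :
    (forall t a, hom_diff (line V V' t) (line W W' t) (fun x => mxev t (F x)) a = 0) ->
  forall a, hom_diff V W (fun x => mxtan (F x)) a =
            - hom_diff V' W' (fun x => mxev 0 (F x)) a.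
Proof.
move=> F0 a.
pose G := F (src a) *m (mxC (W a) + 'X *: mxC (W' a)) -
          (mxC (V a) + 'X *: mxC (V' a)) *m F (tgt a).
have G0 : G = 0.
  apply/matrixP => i j; rewrite [RHS]mxE; apply/cofin_poly_eq0/cofinT => t.
  rewrite -mxevE mxevB !mxevM !mxevD !mxevZ !mxevC hornerX.
  by have := F0 t a; rewrite /hom_diff /line => ->; rewrite mxE.
have := congr1 (@mxtan _ _ _) G0; rewrite mxtan0 mxtanD mxtanN !mxtanM.
rewrite !mxtanD !mxtanXZ !mxtanC !mxevD !mxevZ !mxevC hornerX !scale0r !addr0 !add0r.
rewrite [X in _ - X]addrC opprD addrACA => /eqP; rewrite addr_eq0 => /eqP.
exact.
Qed.

(* Rank of [hom_diff] first, then ranks of [f]: both are then constant at the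
   generic points of every curve through (V, W, f). *)
Definition generic_hom (V : mrep K c) (W : mrep K d) f : Prop :=
  [/\ forall a, hom_diff V W f a = 0,
      forall (V' : mrep K c) (W' : mrep K d),
        (\rank (hom_diff_mx V' W') <= \rank (hom_diff_mx V W))%N
    & forall (V' : mrep K c) (W' : mrep K d) g, (forall a, hom_diff V' W' g a = 0) ->
        (\rank (hom_diff_mx V W) <= \rank (hom_diff_mx V' W'))%N ->
      (\sum_x \rank (g x) <= \sum_x \rank (f x))%N].

Lemma generic_hom_exists : exists V W f, generic_hom V W f.
Proof.
have [|[V W] _ /= max1] := @exists_max (mrep K c * mrep K d) (fun=> True)
  (fun VW => \rank (hom_diff_mx VW.1 VW.2)) _ _ (fun VW _ => rank_leq_row _).
  by exists (fun=> 0, fun=> 0).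
pose P (z : (mrep K c * mrep K d) * forall x, 'M[K]_(c x, d x)) :=
  (forall a, hom_diff z.1.1 z.1.2 z.2 a = 0) /\
  (\rank (hom_diff_mx V W) <= \rank (hom_diff_mx z.1.1 z.1.2))%N.
have [||[[V1 W1] f] [/= f0 rk1] max2] :=
  @exists_max _ P (fun z => \sum_x \rank (z.2 x))%N (\sum_x c x)%N.
- exists ((V, W), fun=> 0); split=> // a.
  by rewrite /hom_diff mul0mx mulmx0 subrr.
- by move=> z _; apply: leq_sum => x _; apply: rank_leq_row.
exists V1, W1, f; split=> // [V' W' | V' W' g g0 rk'].
  exact: leq_trans (max1 (V', W') I) rk1.
by apply: (max2 ((V', W'), g)); split=> //=; apply: leq_trans rk1 rk'.
Qed.

(** * Deformations of a generic homomorphism *)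

Section Generic.

Variables (V : mrep K c) (W : mrep K d) (f : forall x, 'M[K]_(c x, d x)).
Hypothesis gen_f : generic_hom V W f.

Let r x := \rank (f x).

(** No rank drops at generic [t], and maximality bounds the sum of the ranks by its value at 0, so
    each rank is unchanged. *)
Lemma generic_curve_rank (V' : mrep K c) (W' : mrep K d)
    (F : forall x, 'M[{poly K}]_(c x, d x)) :
    (forall x, mxev 0 (F x) = f x) ->
    (forall t a, hom_diff (line V V' t) (line W W' t) (fun x => mxev t (F x)) a = 0) ->
  cofin (fun t => forall x, \rank (mxev t (F x)) = r x).
Proof.
move=> F0 homF; have [f0 max1 max2] := gen_f.
have rkF : cofin (fun t => forall x, r x <= \rank (mxev t (F x)))%N.
  by apply: cofin_all => x; rewrite /r -F0; apply: cofin_rank_ge.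
have rkD : cofin (fun t => \rank (hom_diff_mx V W) <=
                   \rank (hom_diff_mx (line V V' t) (line W W' t)))%N.
  have := cofin_rank_ge (mxC (hom_diff_mx V W) + 'X *: mxC (hom_diff_mx V' W')).
  apply: cofinW => t.
  rewrite !mxevD !mxevZ !hornerX !mxevC scale0r addr0.
  by rewrite hom_diff_mx_line.
apply: cofinW (cofinI rkF rkD) => t [leF leD] x; apply/eqP; rewrite eqn_leq leF andbT.
have := max2 _ _ _ (homF t) leD; rewrite (bigD1 x) // [X in (_ <= X)%N](bigD1 x) //=.
rewrite leqNgt => /negP h; rewrite leqNgt; apply/negP => lt_x; apply: h.
by rewrite -addSn leq_add // leq_sum // => y _; apply: leF.
Qed.

Lemma generic_curve (V' : mrep K c) (W' : mrep K d) :
  exists2 F : forall x, 'M[{poly K}]_(c x, d x), forall x, mxev 0 (F x) = f x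
    & forall t a, hom_diff (line V V' t) (line W W' t) (fun x => mxev t (F x)) a = 0.
Proof. by have [f0 max1 _] := gen_f; apply: hom_curve. Qed.

(** Deform [V], respectively [W], towards an arbitrary [v]: kernels, respectively images, keep their
    dimensions along the line, and [closed_sub] reaches [v] at infinity. *)
Lemma generic_hom_gen_sub :
  gen_sub K (fun x => c x - r x)%N c /\ gen_sub K r d.
Proof.
split=> v.
  have [F F0 homF] := generic_curve v (fun=> 0).
  apply: (@closed_sub _ _ v V); apply: cofinW (generic_curve_rank F0 homF) => t rkF.
  by have [] := hom_has_sub rkF (homF t).
have [F F0 homF] := generic_curve (fun=> 0) v.
apply: (@closed_sub _ _ v W); apply: cofinW (generic_curve_rank F0 homF) => t rkF.
by have [] := hom_has_sub rkF (homF t).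
Qed.

(** [g] is the velocity at 0 of the homomorphisms following the deformation; constancy of the ranks
    gives the second property. *)
Lemma generic_tangent (V' : mrep K c) (W' : mrep K d) :
  exists g, (forall a, hom_diff V W g a = - hom_diff V' W' f a)
    /\ forall x (u : 'rV_(c x)), u *m f x = 0 -> (u *m g x <= f x)%MS.
Proof.
have [F F0 homF] := generic_curve V' W'.
have rkF := generic_curve_rank F0 homF.
exists (fun x => mxtan (F x)); split=> [a | x u uf].
  by rewrite (hom_curve_tangent homF); congr (- _); apply: eq_hom_diff.
rewrite -F0; apply: rank_tangent; last by rewrite F0.
by apply: cofinW rkF => t ->; rewrite F0.
Qed.

(** Here [V] and [W] stay fixed and the curve is [f + t g]. *)
Lemma generic_hom_tangent g :
  (forall a, hom_diff V W g a = 0) ->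
  forall x (u : 'rV_(c x)), u *m f x = 0 -> (u *m g x <= f x)%MS.
Proof.
move=> g0 x u uf; have [f0 _ _] := gen_f.
pose F x := mxC (f x) + 'X *: mxC (g x).
have evF t y : mxev t (F y) = t *: g y + f y.
  by rewrite mxevD mxevZ !mxevC hornerX addrC.
have F0 y : mxev 0 (F y) = f y by rewrite evF scale0r add0r.
have homF t a :
    hom_diff (line V (fun=> 0) t) (line W (fun=> 0) t) (fun x => mxev t (F x)) a = 0.
  rewrite hom_diff_line (eq_hom_diff _ _ (evF t)) hom_diffP g0 f0 scaler0 addr0 add0r.
  by rewrite /hom_diff mulmx0 mul0mx subrr scaler0.
have -> : g x = mxtan (F x) by rewrite mxtanD mxtanC mxtanXZ mxevC add0r.
rewrite -F0; apply: rank_tangent; last by rewrite F0.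
by apply: cofinW (generic_curve_rank F0 homF) => t ->; rewrite F0.
Qed.

(* [A] and [B] are S = ker f and C = coker f. Deforming [V] and [W] in all
   directions shows that a family on arrows sending S into im f is the
   [hom_diff] of a family on vertices with the same property; deforming [f]
   alone shows that Hom(V, W) -> Hom(S, C) is zero. Hence Hom(S, C) = 0, and
   Ext(V, W) -> Ext(S, C) is injective. *)
Lemma generic_hom_split :
  exists (A : mrep K (fun x => c x - r x)%N) (B : mrep K (fun x => d x - r x)%N),
    hom_zero A B /\ (ext_zero A B -> ext_zero V W).
Proof.
have [f0 _ _] := gen_f.
have /fin_all_exists[S /fin_all_exists[Si /fin_all_exists[P /fin_all_exists[Pi
  /fin_all_exists[I /fin_all_exists[Ii /fin_all_exists[C /fin_all_exists[Ci
  splf]]]]]]]] x := rank_factorization (erefl (r x)).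
have fVW a : f (src a) *m W a = V a *m f (tgt a) by apply/eqP; rewrite -subr_eq0 -f0.
have splS x : split_mx (S x) (Si x) (P x) (Pi x) by case: (splf x).
have splI x : split_mx (I x) (Ii x) (C x) (Ci x) by case: (splf x).
have fE x : f x = P x *m I x by case: (splf x).
have SVP a : S (src a) *m V a *m P (tgt a) = 0.
  have [_ SP _ _ _] := splS (src a); have [IIi _ _ _ _] := splI (tgt a).
  rewrite -[LHS]mulmx1 -IIi !mulmxA -(mulmxA _ (P _)) -fE -(mulmxA (S _)) -fVW fE.
  by rewrite !mulmxA SP !mul0mx.
have IWC a : I (src a) *m W a *m C (tgt a) = 0.
  have [_ _ _ PiP _] := splS (src a); have [_ IC _ _ _] := splI (tgt a).
  rewrite -[I _]mul1mx -PiP -(mulmxA (Pi _)) -fE -(mulmxA (Pi _)) fVW fE.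
  by rewrite -!mulmxA IC !mulmx0.
pose A : mrep K (fun x => c x - r x)%N := fun a => S (src a) *m V a *m Si (tgt a).
pose B : mrep K (fun x => d x - r x)%N := fun a => Ci (src a) *m W a *m C (tgt a).
have SV a : S (src a) *m V a = A a *m S (tgt a).
  have [_ _ _ _ tot] := splS (tgt a).
  by rewrite -[LHS]mulmx1 -tot mulmxDr !mulmxA SVP mul0mx addr0.
have WC a : W a *m C (tgt a) = C (src a) *m B a.
  have [_ _ _ _ tot] := splI (src a).
  by rewrite -[LHS]mul1mx -tot mulmxDl -!mulmxA (mulmxA (I _)) IWC mulmx0 add0r !mulmxA.
have [lift liftK] : exists lift : (forall x, 'M[K]_(c x - r x, d x - r x)) ->
    forall x, 'M[K]_(c x, d x), forall e x, S x *m lift e x *m C x = e x.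
  exists (fun e x => Si x *m e x *m Ci x) => e x.
  have [SSi _ _ _ _] := splS x; have [_ _ _ CiC _] := splI x.
  by rewrite !mulmxA SSi mul1mx -mulmxA CiC mulmx1.
have lift_diff e a :
    S (src a) *m hom_diff V W (lift e) a *m C (tgt a) = hom_diff A B e a.
  rewrite /hom_diff mulmxBr mulmxBl; congr (_ - _).
    by rewrite -[e (src a)]liftK -!mulmxA WC.
  by rewrite mulmxA SV -[e (tgt a)]liftK !mulmxA.
have inB g : (forall x (u : 'rV_(c x)), u *m f x = 0 -> (u *m g x <= f x)%MS) ->
    forall x, S x *m g x *m C x = 0.
  move=> gP x; have [_ SP _ _ _] := splS x.
  apply/(split_mx_sub _ (splI x))/row_subP => i; rewrite row_mul.
  apply: submx_trans (gP x _ _) _; first by rewrite fE mulmxA -row_mul SP row0 mul0mx.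
  by rewrite fE submxMl.
have correct h : (forall a, S (src a) *m h a *m C (tgt a) = 0) ->
    exists2 g, forall a, hom_diff V W g a = - h a & forall x, S x *m g x *m C x = 0.
  move=> h0.
  have /fin_all_exists[V' /fin_all_exists[W' VW']] a :=
    deformation_solve (splS (src a)) (splI (src a)) (splS (tgt a)) (splI (tgt a))
      (fE (src a)) (fE (tgt a)) (h0 a).
  have [g [gE gP]] := generic_tangent V' W'.
  by exists g; [move=> a; rewrite gE -VW' | apply: inB].
exists A, B; split=> [e e0 x | extAB h].
  have [|g gE g0] := correct (fun a => hom_diff V W (lift e) a).
    by move=> a; rewrite lift_diff e0.
  (* The corrected lift of [e] is a homomorphism from [V] to [W], so it induces zero from S to C;
     but it induces [e]. *)
  have /generic_hom_tangent/inB/(_ x) :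
      forall a, hom_diff V W (fun x => 1 *: lift e x + g x) a = 0.
    by move=> a; rewrite hom_diffP scale1r gE subrr.
  by rewrite scale1r mulmxDr mulmxDl liftK g0 addr0.
have [e eE] := extAB (fun a => S (src a) *m h a *m C (tgt a)).
have [|g gE g0] := correct (fun a => hom_diff V W (lift e) a - h a).
  by move=> a; rewrite mulmxBr mulmxBl lift_diff eE subrr.
exists (fun x => 1 *: lift e x + g x) => a.
by rewrite hom_diffP scale1r gE opprB addrC subrK.
Qed.

Lemma generic_hom_eq0 : (forall x, r x = 0%N) -> hom_zero V W.
Proof.
move=> r0 g g0 x; have [_ _ max2] := gen_f.
have := max2 V W g g0 (leqnn _).
rewrite [X in (_ <= X)%N]big1 => [|y _]; last exact: r0.
by rewrite leqn0 sum_nat_eq0 => /forallP/(_ x)/=; rewrite mxrank_eq0 => /eqP.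
Qed.

End Generic.

End GenericHom.

(** * Destabilizing subrepresentations *)

Section Destabilizing.

Variables (K : numFieldType) (Q : quiver).
Implicit Types b c d r : vertex Q -> nat.

(** The Euler form as the dimension of the source of [hom_diff] minus that of its target. *)
Definition eul b d : int :=
  (\sum_x b x * d x)%:Z - (\sum_a b (src a) * d (tgt a))%:Z.

Lemma eulDl b c r d : (forall x, b x + r x = c x)%N -> eul b d + eul r d = eul c d.
Proof.
move=> bc; rewrite /eul addrACA -opprD -!PoszD -!big_split /=.
by congr (Posz _ - Posz _); apply: eq_bigr => i _; rewrite -mulnDl bc.
Qed.

Lemma eulDr b c r d : (forall x, c x + r x = d x)%N -> eul b c + eul b r = eul b d.
Proof.
move=> cd; rewrite /eul addrACA -opprD -!PoszD -!big_split /=.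
by congr (Posz _ - Posz _); apply: eq_bigr => i _; rewrite -mulnDr cd.
Qed.

Lemma eq_eul b b' d d' : b =1 b' -> d =1 d' -> eul b d = eul b' d'.
Proof.
move=> eb ed; rewrite /eul; congr (Posz _ - Posz _); apply: eq_bigr => i _;
  by rewrite eb ed.
Qed.

Lemma gen_sub_eul_ge0 b d : gen_sub K b d -> 0 <= eul b (fun x => d x - b x)%N.
Proof.
move=> sub_bd; rewrite subr_ge0 lez_nat; apply: (@gen_sub_count K).
suff -> : (fun x => b x + (d x - b x))%N = d by [].
by apply/funext => x; rewrite subnKC // (gen_sub_le x sub_bd).
Qed.

(** Right exactness of Ext(V, -): lift [g] to [W] by the section [Ci], solve there, and project. *)
Lemma ext_zero_quotient b r c d (V : mrep K b) (W : mrep K d) :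
    (forall x, r x + c x = d x)%N -> has_sub r W -> ext_zero V W ->
  exists W' : mrep K c, ext_zero V W'.
Proof.
move=> rcd [B [freeB subB]] extVW.
have /fin_all_exists[Bi /fin_all_exists[C /fin_all_exists[Ci splB]]] x :=
  row_free_split (freeB x) (rcd x).
exists (fun a => Ci (src a) *m W a *m C (tgt a)) => g.
have [f fE] := extVW (fun a => g a *m Ci (tgt a)).
exists (fun x => f x *m C x) => a.
have [_ _ _ CiC _] := splB (tgt a); have [_ _ _ _ tot] := splB (src a).
have BWC : B (src a) *m W a *m C (tgt a) = 0.
  by apply/(split_mx_sub _ (splB (tgt a))).
have -> : hom_diff V (fun a => Ci (src a) *m W a *m C (tgt a)) (fun x => f x *m C x) a =
    hom_diff V W f a *m C (tgt a).
  rewrite /hom_diff mulmxBl !mulmxA; congr (_ - _).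
  rewrite -[in RHS](mulmx1 (f (src a))) -tot mulmxDr !mulmxDl.
  by rewrite -!mulmxA (mulmxA (B _)) BWC !mulmx0 add0r.
by rewrite fE -mulmxA CiC mulmx1.
Qed.

Hypothesis closed_sub : sub_closed K Q.

Lemma ext_nonzero_destabilizing b d :
    (forall (V : mrep K b) (W : mrep K d), ~ ext_zero V W) ->
  exists2 c, gen_sub K c b & eul c d < 0.
Proof.
have [N] := ubnP (\sum_x b x)%N; elim: N b => // N IHN b ltN extN.
have [V [W [f gen_f]]] := generic_hom_exists K b d.
pose r x := \rank (f x).
have [sub1 sub2] := generic_hom_gen_sub closed_sub gen_f.
have [A [B [homAB extAB]]] := generic_hom_split gen_f.
(* Hom(A, B) = 0 gives the weak inequality; equality would make Ext(A, B), hence Ext(V, W),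
   vanish. *)
have ltAB : eul (fun x => b x - r x)%N (fun x => d x - r x)%N < 0.
  rewrite subr_lt0 ltz_nat ltn_neqAle (hom_zero_dim homAB) andbT.
  by apply/negP => /eqP/(hom_zero_dim_eq homAB)/extAB/extN.
have [r0 | [x rx]] : (forall x, r x = 0%N) \/ exists x, r x <> 0%N.
  by case: (pselect (forall x, r x = 0%N)) => [|/existsNP]; [left | right].
  exists b; first exact: gen_sub_refl.
  rewrite (@eq_eul b (fun x => b x - r x)%N d (fun x => d x - r x)%N) // => x;
    by rewrite r0 subn0.
have [||c subc negc] := IHN (fun x => b x - r x)%N.
- rewrite -ltnS; apply: leq_trans ltN; rewrite ltnS.
  rewrite [X in (_ <= X)%N](bigD1 x) //= (bigD1 x) //=.
  rewrite -addSn leq_add //; last by apply: leq_sum => y _; apply: leq_subr.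
  by have := rank_leq_row (f x); rewrite -/(r x); lia.
- move=> V' W' ext'.
  (* [W'] has a subrepresentation of dimension [r]; on the quotient by it Ext still vanishes, which
     contradicts [ltAB]. *)
  have rd x' : (r x' + (d x' - r x') = d x')%N by apply/subnKC/rank_leq_col.
  have [W''] := ext_zero_quotient rd (sub2 W') ext'.
  by move=> /ext_zero_dim; move: ltAB; rewrite subr_lt0 ltz_nat ltnNge => /negP.
by exists c => //; apply: gen_sub_trans subc sub1.
Qed.

(* Among the [c <=_Q b] minimizing [eul c d], take one of least total
   dimension: a nonzero generic map from it to the quotient would have a kernel
   contradicting minimality. *)
Lemma destabilizing_rigid b d :
    (exists2 c, gen_sub K c b & eul c d < 0) ->
  exists c, [/\ gen_sub K c b, eul c d < 0 & eul c (fun x => b x - c x)%N <= 0].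
Proof.
move=> [c0 sub0 neg0].
pose M := (\sum_x b x * d x)%N; pose M' := (\sum_a b (src a) * d (tgt a))%N.
have bound c : gen_sub K c b -> - M'%:Z <= eul c d <= M%:Z.
  move=> subc; have lecb x := gen_sub_le x subc.
  have : (\sum_x c x * d x <= M)%N by apply: leq_sum => x _; rewrite leq_mul2r lecb orbT.
  have : (\sum_a c (src a) * d (tgt a) <= M')%N.
    by apply: leq_sum => a _; rewrite leq_mul2r lecb orbT.
  by rewrite /eul; lia.
(* Minimizing [eul c d] is maximizing [M - eul c d], which is a natural number by [bound]. *)
have [||c1 sub1 min1] := @exists_max _ (fun c => gen_sub K c b)
  (fun c => `|M%:Z - eul c d|%N) (M + M')%N.
- by exists c0.
- by move=> c /bound; lia.
have {}min1 c : gen_sub K c b -> eul c1 d <= eul c d.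
  by move=> subc; have := min1 c subc; have := bound _ subc; have := bound _ sub1; lia.
have [||c [subc eqc] min2] := @exists_max _
  (fun c => gen_sub K c b /\ eul c d = eul c1 d) (fun c => \sum_x b x - \sum_x c x)%N
  (\sum_x b x)%N.
- by exists c1.
- by move=> c _; apply: leq_subr.
have le_sum r : gen_sub K r b -> (\sum_x r x <= \sum_x b x)%N.
  by move=> subr; apply: leq_sum => x _; apply: gen_sub_le subr.
exists c; split=> //; first by rewrite eqc; apply: le_lt_trans neg0; apply: min1.
have [V [W [f gen_f]]] := generic_hom_exists K c (fun x => b x - c x)%N.
pose r x := \rank (f x).
have [subk subi] : gen_sub K (fun x => c x - r x)%N c /\
    gen_sub K r (fun x => b x - c x)%N := generic_hom_gen_sub closed_sub gen_f.
have [r0 | [x rx]] : (forall x, r x = 0%N) \/ exists x, r x <> 0%N.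
  by case: (pselect (forall x, r x = 0%N)) => [|/existsNP]; [left | right].
  have /hom_zero_dim := generic_hom_eq0 gen_f r0.
  by rewrite subr_le0 lez_nat.
have lerc y : (r y <= c y)%N by apply: rank_leq_row.
(* The kernel has dimension [c - r], and the preimage of the image has dimension [c + r]. Minimality
   at both forces [eul r d = 0], so the kernel is a smaller minimizer. *)
have subk' := gen_sub_trans subk subc.
have subi' := gen_sub_add (fun y => subnKC (gen_sub_le y subc)) subc subi.
have := min1 _ subk'; have := min1 _ subi'.
have eqk := eulDl d (fun y => subnK (lerc y)).
have eqi := eulDl (b := c) (r := r) d (fun=> erefl).
rewrite -eqi => le1 le2.
have /min2 : gen_sub K (fun y => c y - r y)%N b /\
    eul (fun y => c y - r y)%N d = eul c1 d by split=> //; lia.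
have : (\sum_y (c y - r y) < \sum_y c y)%N.
  rewrite [X in (_ < X)%N](bigD1 x) //= (bigD1 x) //= -addSn leq_add //.
    by have := lerc x; lia.
  by apply: leq_sum => y _; apply: leq_subr.
by have := le_sum _ subc; lia.
Qed.

End Destabilizing.

(** * Generic solvability of polynomial systems *)

Section BoxPolyCurves.

Variables (K : numFieldType) (J : finType).

Lemma box_poly_curve E (g : (J -> K) -> K) (e : J -> {poly K}) :
  box_poly E g -> exists p : {poly K}, forall s, g (fun j => (e j).[s]) = p.[s].
Proof.
move=> [s _ gE]; exists (\sum_(m <- s) m.1%:P * \prod_j e j ^+ m.2 j) => t.
rewrite gE horner_sum; apply: eq_bigr => m _; rewrite hornerCM; congr (_ * _).
by rewrite horner_prod; apply: eq_bigr => j _; rewrite horner_exp.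
Qed.

(** Congruence modulo ['X^k] is compatible with sums and products, hence with evaluating a
    polynomial. *)
Lemma box_poly_curve_congr E (g : (J -> K) -> K) (e h : J -> {poly K}) k :
    box_poly E g ->
  exists p q : {poly K}, (forall s, g (fun j => (e j).[s]) = p.[s]) /\
    forall s, g (fun j => (e j + 'X^k * h j).[s]) = (p + 'X^k * q).[s].
Proof.
move=> gP; have [s _ gE] := gP.
pose cg (a b : {poly K}) := exists q, b = a + 'X^k * q.
have cgD a b a' b' : cg a b -> cg a' b' -> cg (a + a') (b + b').
  by move=> [q ->] [q' ->]; exists (q + q'); rewrite mulrDr addrACA.
have cgM a b a' b' : cg a b -> cg a' b' -> cg (a * a') (b * b').
  move=> [q ->] [q' ->]; exists (q * a' + a * q' + 'X^k * q * q').
  by ring.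
have cgR a : cg a a by exists 0; rewrite mulr0 addr0.
pose ev (e : J -> {poly K}) := \sum_(m <- s) m.1%:P * \prod_j e j ^+ m.2 j.
have evE e' t : g (fun j => (e' j).[t]) = (ev e').[t].
  rewrite gE horner_sum; apply: eq_bigr => m _; rewrite hornerCM; congr (_ * _).
  by rewrite horner_prod; apply: eq_bigr => j _; rewrite horner_exp.
have [q eq_q] : cg (ev e) (ev (fun j => e j + 'X^k * h j)).
  rewrite /ev; apply: (big_ind2 cg (cgR 0) cgD) => m _; apply: (cgM); first exact: cgR.
  apply: (big_ind2 cg (cgR 1) cgM) => j _; elim: (m.2 j) => [|i IHi].
    by rewrite !expr0.
  by rewrite !exprS; apply: cgM => //; exists (h j).
by exists (ev e), q; split=> t; rewrite -?eq_q ?evE // (evE (fun j => e j + 'X^k * h j)).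
Qed.

(** On the line through [x] and [y] both functions become nonzero polynomials in one variable. *)
Lemma box_poly_mul_neq0 E E' (f g : (J -> K) -> K) :
    box_poly E f -> box_poly E' g ->
    (exists x, f x != 0) -> (exists x, g x != 0) ->
  exists x, f x * g x != 0.
Proof.
move=> fP gP [x fx] [y gy].
pose e j := (x j)%:P + 'X * (y j - x j)%:P.
have e0 : (fun j => (e j).[0]) = x.
  by apply/funext => j; rewrite /e !hornerE.
have e1 : (fun j => (e j).[1]) = y.
  by apply/funext => j; rewrite /e hornerD hornerM hornerX !hornerC mul1r addrC subrK.
have [p fp] := box_poly_curve e fP; have [q gq] := box_poly_curve e gP.
have p0 : p != 0 by apply: contraNneq fx => p0; rewrite -e0 fp p0 horner0.
have q0 : q != 0 by apply: contraNneq gy => q0; rewrite -e1 gq q0 horner0.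
have [t [pt qt]] := cofin_ex (cofinI (cofin_poly p0) (cofin_poly q0)).
by exists (fun j => (e j).[t]); rewrite fp gq mulf_neq0.
Qed.

End BoxPolyCurves.

(** * Constructible sets through quantifier elimination *)

Section Chevalley.

Variable K : numClosedFieldType.

Lemma box_poly_term (J : finType) E (g : (J -> K) -> K) : box_poly E g ->
  exists t : GRing.term K,
    GRing.rterm t /\ forall x, g x = GRing.eval (codom x) t.
Proof.
move=> [s _ gE].
pose mon (m : {ffun J -> nat}) : GRing.term K :=
  \big[GRing.Mul/1%:R%T]_j (GRing.Exp 'X_(enum_rank j) (m j))%T.
exists (\big[GRing.Add/0%:R%T]_(m <- s) (GRing.Mul (GRing.Const m.1) (mon m.2)))%T.
split=> [|x].
  have rterm_big (T : Type) (r : seq T) (op : GRing.term K -> _ -> _) t0 G :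
      GRing.rterm t0 ->
      (forall t1 t2, GRing.rterm t1 -> GRing.rterm t2 -> GRing.rterm (op t1 t2)) ->
      (forall i, GRing.rterm (G i)) -> GRing.rterm (\big[op/t0]_(i <- r) G i).
    by move=> *; apply: (big_ind (fun t : GRing.term K => is_true (GRing.rterm t))).
  apply: (rterm_big) => //= [? ? -> -> //|m].
  by apply: (rterm_big) => //= ? ? -> ->.
rewrite gE; apply: (big_rec2 (fun a t => a = GRing.eval (codom x) t)) => //= m ? ? _ ->.
congr (_ * _ + _).
apply: (big_rec2 (fun a t => a = GRing.eval (codom x) t)) => //= j ? ? _ ->.
by rewrite nth_codom enum_rankK.
Qed.

Lemma term_box_poly (J : finType) (t : GRing.term K) : GRing.rterm t ->
  exists E, box_poly E (fun x : J -> K => GRing.eval (codom x) t).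
Proof.
have ext E (g h : (J -> K) -> K) : g =1 h -> box_poly E g -> box_poly E h.
  by move=> gh [s sE gE]; exists s => // x; rewrite -gh.
elim: t => //=.
- move=> n _; exists 1%N; have [ltn | len] := ltnP n #|J|.
    apply: ext (box_polyX K (enum_val (Ordinal ltn))) => x.
    by rewrite -[n]/(nat_of_ord (Ordinal ltn)) nth_codom.
  apply: ext (box_polyC J 1 0) => x; rewrite nth_default //.
  by rewrite size_codom.
- by move=> a _; exists 0%N; apply: box_polyC.
- by move=> a _; exists 0%N; apply: box_polyC.
- move=> t1 IH1 t2 IH2 /andP[/IH1[E1 P1] /IH2[E2 P2]]; exists (maxn E1 E2).
  by apply: box_polyD; [apply: box_polyW P1 | apply: box_polyW P2];
    rewrite ?leq_maxl ?leq_maxr.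
- by move=> t1 IH1 /IH1[E1 P1]; exists E1; apply: box_polyN.
- move=> t1 IH1 n /IH1[E1 P1]; exists (0 + E1)%N.
  apply: ext (box_polyM (box_polyC J 0 n%:R) P1) => x.
  by rewrite mulr_natl.
- by move=> t1 IH1 t2 IH2 /andP[/IH1[E1 P1] /IH2[E2 P2]]; exists (E1 + E2)%N;
    apply: box_polyM.
- by move=> t1 IH1 n /IH1[E1 P1]; exists (n * E1)%N; apply: box_poly_exp.
Qed.

(** A constructible set contains or misses a nonempty open set. For an equation, either the
    difference of its sides is nonzero somewhere and serves as [F], or the equation always holds;
    connectives multiply the [F]. *)
Lemma qf_generic (J : finType) (f : GRing.formula K) :
    GRing.qf_form f -> GRing.rformula f ->
  exists E F (b : bool), [/\ box_poly E F, exists x : J -> K, F x != 0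
    & forall x, F x != 0 -> GRing.qf_eval (codom x) f = b].
Proof.
have const (b : bool) (P : (J -> K) -> bool) : (forall x, P x = b) ->
    exists E F (b : bool), [/\ box_poly E F, exists x : J -> K, F x != 0
    & forall x, F x != 0 -> P x = b].
  move=> Pb; exists 0%N, (fun=> 1), b; split=> //; first exact: box_polyC.
  by exists (fun=> 0); rewrite oner_eq0.
have bin (op : bool -> bool -> bool) (P1 P2 : (J -> K) -> bool) :
    (exists E F (b : bool), [/\ box_poly E F, exists x : J -> K, F x != 0
      & forall x, F x != 0 -> P1 x = b]) ->
    (exists E F (b : bool), [/\ box_poly E F, exists x : J -> K, F x != 0
      & forall x, F x != 0 -> P2 x = b]) ->
    exists E F (b : bool), [/\ box_poly E F, exists x : J -> K, F x != 0
      & forall x, F x != 0 -> op (P1 x) (P2 x) = b].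
  move=> [E1 [F1 [b1 [bF1 ex1 F1b]]]] [E2 [F2 [b2 [bF2 ex2 F2b]]]].
  exists (E1 + E2)%N, (fun x => F1 x * F2 x), (op b1 b2); split.
  - exact: box_polyM.
  - exact: box_poly_mul_neq0 bF1 bF2 ex1 ex2.
  by move=> x; rewrite mulf_eq0 negb_or => /andP[/F1b-> /F2b->].
elim: f => //=.
- by move=> b _ _; apply: (const b).
- move=> t1 t2 _ /andP[/(@term_box_poly J)[E1 P1] /(@term_box_poly J)[E2 P2]].
  pose g (x : J -> K) := GRing.eval (codom x) t1 - GRing.eval (codom x) t2.
  have [ex_g | nex_g] := pselect (exists x : J -> K, g x != 0).
    exists (maxn E1 E2), g, false; split=> // [|x].
      by apply: box_polyD; [apply: box_polyW P1 | apply: box_polyN; apply: box_polyW P2];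
        rewrite ?leq_maxl ?leq_maxr.
    by rewrite /g subr_eq0 => /negPf.
  apply: (const true) => x /=; rewrite -subr_eq0; apply/negPn/negP => gx.
  by apply: nex_g; exists x.
- by move=> f1 IH1 f2 IH2 /andP[q1 q2] /andP[r1 r2]; apply: (bin); auto.
- by move=> f1 IH1 f2 IH2 /andP[q1 q2] /andP[r1 r2]; apply: (bin); auto.
- by move=> f1 IH1 f2 IH2 /andP[q1 q2] /andP[r1 r2]; apply: (bin implb); auto.
move=> f1 IH1 q1 r1; apply: (bin (fun b _ => ~~ b) _ (fun=> true)); first exact: IH1.
exact: (const true).
Qed.

Lemma holds_exists_block (f : GRing.formula K) k (e : seq K) :
  GRing.holds e (foldr (@GRing.Exists K) f (iota (size e) k)) <->
  exists2 s : seq K, size s = k & GRing.holds (e ++ s) f.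
Proof.
elim: k e => [|k IHk] e /=.
  split=> [ef | [[|//] _]]; last by rewrite cats0.
  by exists [::]; rewrite ?cats0.
have eS x : iota (size e).+1 k = iota (size (rcons e x)) k by rewrite size_rcons.
have eR x : set_nth 0 e (size e) x = rcons e x.
  by elim: (e) => //= y e' ->.
split=> [[x] | [[|x s] //= [ss]]].
  rewrite eR (eS x) => /IHk[s ss]; rewrite cat_rcons; exists (x :: s) => //=.
  by rewrite ss.
rewrite -cat_rcons => es; exists x; rewrite eR (eS x); apply/IHk.
by exists s.
Qed.

Lemma codom_sum (J Y : finType) (x : J -> K) (y : Y -> K) :
  codom (fun z : J + Y => match z with inl j => x j | inr i => y i end) =
  codom x ++ codom y.
Proof.
rewrite /codom /image_mem !enumT unlock /= /sum_enum map_cat -!map_comp.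
by rewrite !unlock.
Qed.

(* A system of polynomial equations is solvable for all or for no parameter
   in a nonempty Zariski open set. *)
Lemma generic_solvability (J Y S : finType) k (g : S -> (J + Y -> K) -> K) :
    (forall s, box_poly k (g s)) ->
  exists E F, [/\ box_poly E F, exists x : J -> K, F x != 0
    & (forall x, F x != 0 -> exists y : Y -> K, forall s,
         g s (fun z => match z with inl j => x j | inr i => y i end) = 0)
      \/ (forall x, F x != 0 -> ~ exists y : Y -> K, forall s,
         g s (fun z => match z with inl j => x j | inr i => y i end) = 0)].
Proof.
move=> gP; have /fin_all_exists[t tP] s := box_poly_term (gP s).
pose f := \big[GRing.And/GRing.True%T]_s (GRing.Equal (t s) 0%:R)%T.
have rf : GRing.rformula f.
  apply: (big_ind (fun h : GRing.formula K => GRing.rformula h)) => //=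
    [? ? -> -> // | s _].
  by rewrite (proj1 (tP s)).
have holds_f x (y : Y -> K) : GRing.holds (codom x ++ codom y) f <->
    forall s, g s (fun z => match z with inl j => x j | inr i => y i end) = 0.
  rewrite -codom_sum.
  set z := fun z => _; rewrite (_ : (forall s, g s z = 0) <->
      (forall s, s \in index_enum S -> g s z = 0)).
    rewrite /f; elim: (index_enum S) => [|s r IHr]; first by rewrite big_nil.
    rewrite big_cons /= IHr -(proj2 (tP s)); split=> [[gs gr] i|gr].
      by rewrite inE => /orP[/eqP-> | /gr].
    by split=> [|i ir]; apply: gr; rewrite inE ?eqxx ?ir ?orbT.
  by split=> gs s; [|move: (mem_index_enum s)]; auto.
(* The parameters occupy the first [#|J|] variables and the unknowns the next [#|Y|]; only the
   latter are quantified. *)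
pose ef := foldr (@GRing.Exists K) f (iota #|J| #|Y|).
have ref : GRing.rformula ef by rewrite /ef; elim: iota.
have F_closed := @GRing.solve_monicpoly K.
have /andP[qfq rq] := GRing.quantifier_elim_wf (@ClosedFieldQE.wf_ex_elim K) ref.
have [E [F [b [bF exF Fb]]]] := @qf_generic J _ qfq rq.
have solvE x : reflect (exists y : Y -> K, forall s,
     g s (fun z => match z with inl j => x j | inr i => y i end) = 0) 
    (GRing.qf_eval (codom x) (GRing.quantifier_elim (@ClosedFieldQE.ex_elim K) ef)).
  have sz_x : size (codom x) = #|J| by rewrite size_codom.
  apply: (iffP (GRing.quantifier_elim_rformP (@ClosedFieldQE.wf_ex_elim K)
    (ClosedFieldQE.holds_ex_elim F_closed) (codom x) ref)).
    rewrite /ef -sz_x => /holds_exists_block[s sz_s].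
    pose y i := nth 0 s (@enum_rank Y i).
    have -> : s = codom y.
      apply: (@eq_from_nth _ 0) => [|k0]; first by rewrite size_codom.
      rewrite sz_s => lti; rewrite -[k0]/(nat_of_ord (Ordinal lti)) nth_codom.
      by rewrite /y enum_valK.
    by move=> /holds_f; exists y.
  move=> [y /holds_f fy]; rewrite /ef -sz_x; apply/holds_exists_block.
  by exists (codom y); rewrite ?size_codom.
exists E, F; split=> //; case: b Fb => Fb; [left | right] => x /Fb Fx.
  by apply/solvE; rewrite Fx.
by move/solvE; rewrite Fx.
Qed.

End Chevalley.

(** * Vanishing of Ext yields subrepresentations *)

Section Dominance.

Variables (K : numClosedFieldType) (Q : quiver).

Definition fmat (R : Type) (T : finType) (m n : T -> nat) (y : hidx m n -> R) t :
    'M[R]_(m t, n t) :=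
  \matrix_(i, j) y (Tagged (fun t => 'I_(m t) * 'I_(n t))%type (i, j)).

Definition fvec (R : Type) (T : finType) (m n : T -> nat)
    (F : forall t, 'M[R]_(m t, n t)) (k : hidx m n) : R :=
  F (tag k) (tagged k).1 (tagged k).2.

Lemma fvecK (R : Type) (T : finType) (m n : T -> nat)
    (F : forall t, 'M[R]_(m t, n t)) t :
  fmat (fvec F) t = F t.
Proof. by apply/matrixP => i j; rewrite mxE. Qed.

Notation rep_idx d := (@hidx (arrow Q) (d \o @src Q) (d \o @tgt Q)).

Definition rep_of (d : vertex Q -> nat) (x : rep_idx d -> K) : mrep K d :=
  @fmat _ (arrow Q) (d \o @src Q) (d \o @tgt Q) x.

Lemma has_sub_eq (b d : vertex Q -> nat) (v w : mrep K d) :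
  (forall a, v a = w a) -> has_sub b v -> has_sub b w.
Proof.
by move=> vw [B [freeB subB]]; exists B; split=> // a; rewrite -vw.
Qed.

(** The property is the solvability of [B L = 1], [B V = C B]: [L] witnesses independent rows and
    [C] is the induced representation. *)
Lemma has_sub_generic (b d : vertex Q -> nat) :
  exists E F, [/\ box_poly E F, exists x : rep_idx d -> K, F x != 0
    & (forall x, F x != 0 -> has_sub b (rep_of x)) \/
      (forall x, F x != 0 -> ~ has_sub b (rep_of x))].
Proof.
pose J := rep_idx d.
pose Y : finType := (hidx b d + (hidx d b + rep_idx b))%type.
pose S : finType := (hidx b b + @hidx (arrow Q) (b \o @src Q) (d \o @tgt Q))%type.
pose B (z : J + Y -> K) x := fmat (fun k : hidx b d => z (inr (inl k))) x.
pose L (z : J + Y -> K) x := fmat (fun k : hidx d b => z (inr (inr (inl k)))) x.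
pose C (z : J + Y -> K) a : 'M_(b (src a), b (tgt a)) :=
  @fmat _ (arrow Q) (b \o @src Q) (b \o @tgt Q) (fun k => z (inr (inr (inr k)))) a.
pose V (z : J + Y -> K) := rep_of (fun k => z (inl k)).
pose g (s : S) (z : J + Y -> K) : K := match s with
  | inl k => fvec (fun x => B z x *m L z x - 1%:M) k
  | inr k => @fvec _ (arrow Q) (b \o @src Q) (d \o @tgt Q)
      (fun a => B z (src a) *m V z a - C z a *m B z (tgt a)) k
  end.
have gP s : box_poly 2 (g s).
  case: s => [k | k].
    apply: (@box_mxD K (J + Y)%type 2 _ _ (fun z => B z (tag k) *m L z (tag k))
      (fun=> - 1%:M)).
      by apply: (box_mxM (k := 1)); apply: box_mx_var.
    by move=> i j; apply: box_polyC.
  apply: (@box_mxD K (J + Y)%type 2 _ _ (fun z => B z (src (tag k)) *m V z (tag k))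
    (fun z => - (C z (tag k) *m B z (tgt (tag k))))); last apply: box_mxN;
  by apply: (box_mxM (k := 1)); apply: box_mx_var.
have [E [F [FP exF genF]]] := generic_solvability gP.
have solvE x : has_sub b (rep_of x) <-> exists y : Y -> K, forall s,
    g s (fun z => match z with inl j => x j | inr i => y i end) = 0.
  split=> [[B0 [freeB subB]] | [y gy]].
    have /fin_all_exists[C0 eC] a := submxP (subB a).
    have /fin_all_exists[L0 BL] z := row_freeP (freeB z).
    exists (fun k => match k with
      | inl k => fvec B0 k | inr (inl k) => fvec L0 k
      | inr (inr k) => @fvec _ (arrow Q) (b \o @src Q) (b \o @tgt Q) C0 k end).
    case=> k; rewrite /g /fvec /=.
      by rewrite /B /L !fvecK BL subrr mxE.
    by rewrite /B /C /V /= !fvecK eC subrr mxE.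
  set z := (fun z => _) in gy.
  exists (B z); split=> [x0 | a].
    apply/row_freeP; exists (L z x0); apply/eqP; rewrite -subr_eq0; apply/eqP.
    apply/matrixP => i j; rewrite [RHS]mxE.
    exact: (gy (inl (Tagged (fun x => 'I_(b x) * 'I_(b x))%type (i, j)))).
  have -> : B z (src a) *m rep_of x a = C z a *m B z (tgt a).
    apply/eqP; rewrite -subr_eq0; apply/eqP/matrixP => i j; rewrite [RHS]mxE.
    exact: (gy (inr (Tagged (fun a => 'I_(b (src a)) * 'I_(d (tgt a)))%type (i, j)))).
  exact: submxMl.
exists E, F; split=> //; case: genF => genF; [left | right] => x Fx.
  by apply/solvE/genF.
by move=> /solvE; apply: genF.
Qed.

Lemma poly_const_split (p : {poly K}) : exists q, p = p.[0]%:P + 'X * q.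
Proof.
have /factor_theorem[q] : root (p - p.[0]%:P) 0.
  by rewrite rootE !hornerE subrr.
rewrite subr0 => /eqP; rewrite subr_eq => /eqP pE.
by exists q; rewrite {1}pE mulrC addrC.
Qed.

Lemma mx_const_split m n (A : 'M[{poly K}]_(m, n)) :
  exists A', A = mxC (mxev 0 A) + 'X *: A'.
Proof.
have /fin_all_exists[q qP] (k : 'I_m * 'I_n) := poly_const_split (A k.1 k.2).
by exists (\matrix_(i, j) q (i, j)); apply/matrixP => i j; rewrite !mxE -(qP (i, j)).
Qed.

(* By [graph_stable], the graph of [E] is a subrepresentation of the deformation
   [(V, 0; 0, W) + 'X (a, b; c, d)] up to an error of order ['X^k]. *)
Lemma graph_power_series (m n : vertex Q -> nat) (V : mrep K m) (W : mrep K n)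
    (a : mrep K m) (d : mrep K n) (b : forall e, 'M[K]_(m (src e), n (tgt e)))
    (c : forall e, 'M[K]_(n (src e), m (tgt e))) (k : nat) :
    ext_zero V W ->
  exists (E : forall x, 'M[{poly K}]_(m x, n x))
         (res : forall e, 'M[{poly K}]_(m (src e), n (tgt e))),
    forall e, 'X *: (mxC (b e) + E (src e) *m mxC (d e)
         - (mxC (a e) + E (src e) *m mxC (c e)) *m E (tgt e))
      + (E (src e) *m mxC (W e) - mxC (V e) *m E (tgt e)) = 'X^k *: res e.
Proof.
move=> extVW; elim: k => [|k [E [res eqE]]].
  by eexists (fun=> 0), _ => e; rewrite expr0 scale1r.
have [f fE] := extVW (fun e => mxev 0 (res e)).
have /fin_all_exists[res1 eqr] e := mx_const_split (res e).
(* Changing the graph at order [k] by [f] cancels the constant term of the residue; the remaining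
   effects carry an extra factor ['X]. *)
pose Z x := 'X^k *: mxC (f x).
exists (fun x => E x - Z x), (fun e => res1 e + (- (mxC (f (src e)) *m mxC (d e))
  + (mxC (a e) + E (src e) *m mxC (c e)) *m mxC (f (tgt e))
  + mxC (f (src e)) *m mxC (c e) *m (E (tgt e) - Z (tgt e)))) => e.
have ZWV : Z (src e) *m mxC (W e) - mxC (V e) *m Z (tgt e) = 'X^k *: mxC (mxev 0 (res e)).
  rewrite /Z -scalemxAl -scalemxAr -scalerBr -!map_mxM -map_mxB.
  by congr (_ *: mxC _); rewrite -fE.
have {}eqE := eqE e.
transitivity ('X *: (mxC (b e) + E (src e) *m mxC (d e)
         - (mxC (a e) + E (src e) *m mxC (c e)) *m E (tgt e))
      + (E (src e) *m mxC (W e) - mxC (V e) *m E (tgt e))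
      + 'X *: (- (Z (src e) *m mxC (d e))
          + (mxC (a e) + E (src e) *m mxC (c e)) *m Z (tgt e)
          + Z (src e) *m mxC (c e) *m (E (tgt e) - Z (tgt e)))
      - (Z (src e) *m mxC (W e) - mxC (V e) *m Z (tgt e))).
  rewrite /= !(mulmxBl, mulmxBr, mulmxDl).
  by apply/matrixP => i j; rewrite !mxE; ring.
rewrite eqE ZWV {1}eqr /Z -!scalemxAl -!scalemxAr.
set r0 := mxC (mxev 0 (res e)); set P1 := _ *m mxC (d e).
set P2 := _ *m mxC (f (tgt e)); set P3 := _ *m (E (tgt e) - _).
by apply/matrixP => i j; rewrite !mxE exprS; ring.
Qed.

(* Representations with a subrepresentation form a curve agreeing to high order
   with a line through a generic point, so they are on the generic side of
   [has_sub_generic]. *)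
Theorem ext_zero_gen_sub (m n : vertex Q -> nat) (V : mrep K m) (W : mrep K n) :
  sub_closed K Q -> ext_zero V W -> gen_sub K m (fun x => m x + n x)%N.
Proof.
move=> closed_sub extVW; pose d x := (m x + n x)%N.
have [deg [F [FP [x1 Fx1] genF]]] := has_sub_generic m d.
pose v0 : mrep K d := fun a => block_mx (V a) 0 0 (W a).
pose x0 : rep_idx d -> K := @fvec _ (arrow Q) (d \o @src Q) (d \o @tgt Q) v0.
pose v1 : mrep K d := rep_of (fun j => x1 j - x0 j).
pose e j := (x0 j)%:P + 'X * (x1 j - x0 j)%:P.
have e1 : (fun j => (e j).[1]) = x1.
  by apply/funext => j; rewrite /e hornerD hornerM hornerX !hornerC mul1r addrC subrK.
have [p0 Fp0] := box_poly_curve e FP.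
have p0_neq0 : p0 != 0 by apply: contraNneq Fx1 => p00; rewrite -e1 Fp0 p00 horner0.
(* With this order, a term ['X^k * q] with [q] nonzero has larger size than [p0], so it cannot
   cancel [p0]. *)
pose k := size p0.
have [E [res eqE]] := graph_power_series (fun a => ulsubmx (v1 a))
  (fun a => drsubmx (v1 a)) (fun a => ursubmx (v1 a)) (fun a => dlsubmx (v1 a)) k extVW.
(* Subtracting the error from the upper right block makes the graph exactly stable. *)
pose h : rep_idx d -> {poly K} := @fvec _ (arrow Q) (d \o @src Q) (d \o @tgt Q)
  (fun a => block_mx 0 (- res a) 0 0).
have [p [q [Fp Fpq]]] := box_poly_curve_congr e h k FP.
have pq0 : p + 'X^k * q != 0.
  have ->: p = p0.
    by apply/eqP; rewrite -subr_eq0; apply/eqP/cofin_poly_eq0/cofinT => s;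
       rewrite hornerD hornerN -Fp -Fp0 subrr.
  apply: contraNneq p0_neq0 => /eqP; rewrite addr_eq0 => /eqP p0E.
  have [q0 | q0] := eqVneq q 0; first by rewrite p0E q0 mulr0 oppr0.
  have := congr1 (fun r : {poly K} => size r) p0E.
  rewrite size_polyN -/k mulrC size_mulXn // => /eqP.
  by rewrite -[X in X == _]addn0 eqn_add2l eq_sym size_poly_eq0 => /eqP q00; case/eqP: q0.
have {}genF x : F x != 0 -> has_sub m (rep_of x).
  case: genF => [|nsub]; first exact.
  have [s] := cofin_ex (cofin_poly pq0); rewrite -Fpq => /nsub[].
  exists (fun x => row_mx 1%:M (mxev s (E x))); split=> [y | a].
    by apply/row_freeP; exists (col_mx 1%:M 0); rewrite mul_row_col mulmx1 mulmx0 addr0.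
  have -> : rep_of (fun j => (e j + 'X^k * h j).[s]) a =
      block_mx (V a + s *: ulsubmx (v1 a)) (s *: ursubmx (v1 a) - s ^+ k *: mxev s (res a))
        (s *: dlsubmx (v1 a)) (W a + s *: drsubmx (v1 a)).
    have -> : rep_of (fun j => (e j + 'X^k * h j).[s]) a = v0 a + s *: v1 a +
        s ^+ k *: mxev s (block_mx 0 (- res a) 0 0).
      apply/matrixP => i j; rewrite /rep_of /v1 /rep_of /fmat /e /h /x0 /fvec.
      rewrite [LHS]mxE !mxE /=.
 by rewrite !hornerD !hornerM hornerX hornerXn !hornerC.
    rewrite -[in LHS](submxK (v1 a)) [mxev _ _]map_block_mx !scale_block_mx !add_block_mx.
    by rewrite !map_mx0 map_mxN !scaler0 !addr0 !add0r scalerN.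
  apply/graph_stable; rewrite block_mxKul block_mxKur block_mxKdl block_mxKdr.
  have := congr1 (mxev s) (eqE a).
  rewrite mxevD !mxevZ hornerX hornerXn !mxevB !mxevD !mxevM !mxevC !mxevD !mxevM !mxevC.
  move=> <-; rewrite !(mulmxDl, mulmxDr) -!(scalemxAl, scalemxAr).
  by apply/matrixP => i j; rewrite !mxE; ring.
move=> v; pose x := @fvec _ (arrow Q) (d \o @src Q) (d \o @tgt Q) v.
(* The line from the generic point [x1] in direction [v] meets the open set at [t = 0], hence at
   cofinitely many [t]. *)
apply: (closed_sub m d v (rep_of x1)).
have [r Fr] := box_poly_curve (fun j => (x1 j)%:P + 'X * (x j)%:P) FP.
have r0 : r != 0.
  apply: contraNneq Fx1 => r0.
  have -> : x1 = (fun j => ((x1 j)%:P + 'X * (x j)%:P).[0]).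
    by apply/funext => j; rewrite hornerD hornerM hornerX !hornerC mul0r addr0.
  by rewrite Fr r0 horner0.
apply: cofinW (cofin_poly r0) => t; rewrite -Fr => /genF; apply: has_sub_eq => a.
apply/matrixP => i j; rewrite !mxE.
by rewrite hornerD hornerM hornerX !hornerC.
Qed.

End Dominance.

(** * Limits of subrepresentations *)

Section UltraLimits.

Variables (R : realType) (G : set_system nat).
Hypotheses (ultraG : UltraFilter G) (infG : (\oo `<=` G)%classic).

(** By compactness of the segment there is a cluster point, and an ultrafilter converges to its
    cluster points. One ultrafilter serves all matrix entries at once, with no successive extraction
    of subsequences. *)
Lemma ultra_bounded_cvg (u : nat -> R) (M : R) :
  (forall k, `|u k| <= M) -> exists l : R, (u @ G --> l)%classic.
Proof.
move=> uM.
have uGM : G (u @^-1` `[- M, M])%classic.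
  by apply: (@filterE _ G) => k; rewrite /= in_itv /= -ler_norml; apply: uM.
have [l [_ cl]] := @segment_compact _ (- M) M (u @ G)%classic _ uGM.
exists l => U Ul.
have [//|nU] := in_ultra_setVsetC (u @^-1` U)%classic ultraG.
by have [x [/= nUx /nUx]] := cl (~` U)%classic U nU Ul.
Qed.

(** Convergence is taken on real and imaginary parts, so that only limits in [R] occur. *)
Definition clim (z : nat -> R[i]) (l : R[i]) : Prop :=
  ((fun k => complex.Re (z k)) @ G --> complex.Re l)%classic /\
  ((fun k => complex.Im (z k)) @ G --> complex.Im l)%classic.

Lemma clim_unique z l l' : clim z l -> clim z l' -> l = l'.
Proof.
move=> [re_l im_l] [re_l' im_l']; apply/eqP; rewrite eq_complex.
by rewrite (norm_cvg_unique re_l re_l') (norm_cvg_unique im_l im_l') !eqxx.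
Qed.

Lemma clim_cst c : clim (fun=> c) c.
Proof. by split; apply: cvg_cst. Qed.

Lemma climD z z' l l' : clim z l -> clim z' l' -> clim (fun k => z k + z' k) (l + l').
Proof.
move=> [re_l im_l] [re_l' im_l'].
have ReD (x y : R[i]) : complex.Re (x + y) = complex.Re x + complex.Re y.
  by case: x; case: y.
have ImD (x y : R[i]) : complex.Im (x + y) = complex.Im x + complex.Im y.
  by case: x; case: y.
split.
  by rewrite ReD; under eq_fun do rewrite ReD; apply: cvgD.
by rewrite ImD; under eq_fun do rewrite ImD; apply: cvgD.
Qed.

Lemma climM z z' l l' : clim z l -> clim z' l' -> clim (fun k => z k * z' k) (l * l').
Proof.
move=> [re_l im_l] [re_l' im_l'].
have ReM (x y : R[i]) : complex.Re (x * y) =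
    complex.Re x * complex.Re y - complex.Im x * complex.Im y by case: x; case: y.
have ImM (x y : R[i]) : complex.Im (x * y) =
    complex.Re x * complex.Im y + complex.Im x * complex.Re y by case: x; case: y.
split.
  by rewrite ReM; under eq_fun do rewrite ReM; apply: cvgB; apply: cvgM.
by rewrite ImM; under eq_fun do rewrite ImM; apply: cvgD; apply: cvgM.
Qed.

Lemma clim_sum n (z : 'I_n -> nat -> R[i]) l :
  (forall j, clim (z j) (l j)) -> clim (fun k => \sum_j z j k) (\sum_j l j).
Proof.
move=> zl; elim: (index_enum _) => [|j r IHr].
  by rewrite big_nil; under eq_fun do rewrite big_nil; apply: clim_cst.
by rewrite big_cons; under eq_fun do rewrite big_cons; apply: climD.
Qed.

Lemma clim_bounded (z : nat -> R[i]) : (forall k, `|z k| <= 1) -> exists l, clim z l.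
Proof.
move=> z1.
have Re1 k : `|complex.Re (z k)| <= 1.
  by rewrite -lecR; apply: le_trans (normc_ge_Re _) (z1 k).
have Im1 k : `|complex.Im (z k)| <= 1.
  rewrite -lecR -normrN -ReiNIm; apply: le_trans (normc_ge_Re _) _.
  by rewrite normrM normCi mulr1.
have [a ua] := ultra_bounded_cvg Re1; have [b ub] := ultra_bounded_cvg Im1.
by exists (a +i* b)%C.
Qed.

Lemma clim_inv_nat (s : nat -> nat) : (forall k, (k < s k)%N) ->
  clim (fun k => (s k)%:R^-1) 0.
Proof.
move=> ltks.
have inv_nat n : (n%:R^-1 : R[i]) = (n%:R^-1)%:C%C.
  by rewrite fmorphV rmorph_nat.
split; under eq_fun do rewrite inv_nat /=; last exact: cvg_cst.
suff cv : ((fun k => (s k)%:R^-1 : R) @ \oo --> (0 : R))%classic.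
  by move=> U /cv; apply: infG.
apply: (squeeze_cvgr _ (cvg_cst 0) cvg_harmonic).
apply: nearW => k /=; rewrite invr_ge0 ler0n /= lef_pV2 ?posrE ?ltr0n ?ler_nat //.
by apply: leq_trans (ltks k).
Qed.

Definition mxlim (m n : nat) (A : nat -> 'M[R[i]]_(m, n)) (L : 'M[R[i]]_(m, n)) : Prop :=
  forall i j, clim (fun k => A k i j) (L i j).

Lemma mxlim_unique m n (A : nat -> 'M_(m, n)) L L' : mxlim A L -> mxlim A L' -> L = L'.
Proof. by move=> AL AL'; apply/matrixP => i j; apply: clim_unique (AL i j) (AL' i j). Qed.

Lemma mxlim_cst m n (A : 'M_(m, n)) : mxlim (fun=> A) A.
Proof. by move=> i j; apply: clim_cst. Qed.

Lemma mxlimD m n (A B : nat -> 'M_(m, n)) L M :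
  mxlim A L -> mxlim B M -> mxlim (fun k => A k + B k) (L + M).
Proof.
by move=> AL BM i j; rewrite mxE; under eq_fun do rewrite mxE; apply: climD.
Qed.

Lemma mxlimZ m n (z : nat -> R[i]) (A : nat -> 'M_(m, n)) c L :
  clim z c -> mxlim A L -> mxlim (fun k => z k *: A k) (c *: L).
Proof.
by move=> zc AL i j; rewrite mxE; under eq_fun do rewrite mxE; apply: climM.
Qed.

Lemma mxlimM m n p (A : nat -> 'M_(m, n)) (B : nat -> 'M_(n, p)) L M :
  mxlim A L -> mxlim B M -> mxlim (fun k => A k *m B k) (L *m M).
Proof.
move=> AL BM i j; rewrite mxE; under eq_fun do rewrite mxE.
by apply: clim_sum => l; apply: climM.
Qed.

Lemma mxlim_bounded m n (A : nat -> 'M[R[i]]_(m, n)) :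
  (forall k i j, `|A k i j| <= 1) -> exists L, mxlim A L.
Proof.
move=> A1.
have /fin_all_exists[L AL] (ij : 'I_m * 'I_n) := clim_bounded (fun k => A1 k ij.1 ij.2).
exists (\matrix_(i, j) L (i, j)) => i j; rewrite mxE.
exact: (AL (i, j)).
Qed.

End UltraLimits.

(** * Compactness of Grassmannians over the complex numbers *)

Section Closedness.

Variables (R : realType) (Q : quiver).

Local Notation K := (R[i]).

Lemma unitary_entry m n (A : 'M[K]_(m, n)) i j :
  A *m A^t*%sesqui = 1%:M -> `|A i j| <= 1.
Proof.
move=> /matrixP/(_ i i); rewrite !mxE eqxx => Ai.
rewrite -(@expr_le1 _ 2) // -[X in _ <= X]Ai (bigD1 j) //= !mxE -normCK lerDl.
by apply: sumr_ge0 => l _; rewrite !mxE -normCK exprn_ge0.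
Qed.

(** Gram-Schmidt gives orthonormal rows [B], with [D] their conjugate transpose. As [D B] projects
    onto the row space, stability becomes an equation in bounded matrices. *)
Lemma has_sub_unitary (b d : vertex Q -> nat) (v : mrep K d) : has_sub b v ->
  exists (B : forall x, 'M[K]_(b x, d x)) (D : forall x, 'M[K]_(d x, b x)),
    [/\ forall x, B x *m D x = 1%:M,
        forall a, B (src a) *m v a *m (1%:M - D (tgt a) *m B (tgt a)) = 0
      & forall x i j, `|B x i j| <= 1 /\ `|D x j i| <= 1].
Proof.
move=> [B [freeB subB]]; pose U x := spectral.schmidt (B x).
have UB x : (U x :=: B x)%MS by apply: spectral.eqmx_schmidt_free.
have UU x : U x *m (U x)^t*%sesqui = 1%:M.
  apply/spectral.unitarymxP/spectral.schmidt_unitarymx.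
  by have /eqP <- := freeB x; apply: rank_leq_col.
exists U, (fun x => (U x)^t*%sesqui); split=> // [a | x i j].
  have /submxP[X ->] : (U (src a) *m v a <= U (tgt a))%MS.
    by rewrite (eqmxMr _ (UB _)) UB.
  by rewrite mulmxBr mulmx1 mulmxA -(mulmxA X) UU mulmx1 subrr.
by rewrite !mxE norm_conjC; split; apply: unitary_entry.
Qed.

(* Compactness of the Grassmannians: rescale [w + t v] to [v + t^-1 w], choose
   orthonormal bases of the subspaces and pass to a limit as [t -> oo]. *)
Lemma complex_sub_closed : sub_closed K Q.
Proof.
move=> b d v w cof_sub.
have /choice[s sP] k : exists m : nat, (k < m)%N /\ has_sub b (fun a => w a + m%:R *: v a).
  by have [m ltm Pm] := cofin_large k cof_sub; exists m.
have /choice[B /choice[D BDP]] k := has_sub_unitary (proj2 (sP k)).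
have [G [ultraG infG]] := ultraFilterLemma (F := \oo%classic) _.
have bnd x k i j : `|B k x i j| <= 1 by have [_ _ /(_ x i j)[]] := BDP k.
have bnd' x k i j : `|D k x i j| <= 1 by have [_ _ /(_ x j i)[]] := BDP k.
have /fin_all_exists[B0 B0P] x := mxlim_bounded ultraG (bnd x).
have /fin_all_exists[D0 D0P] x := mxlim_bounded ultraG (bnd' x).
(* The right inverse passes to the limit, so the limiting subspace keeps its dimension. *)
have BD0 x : B0 x *m D0 x = 1%:M.
  apply: (mxlim_unique ultraG (mxlimM ultraG (B0P x) (D0P x))).
  under eq_fun => k do [have [-> _ _] := BDP k].
  exact: mxlim_cst.
exists B0; split=> [x | a]; first by apply/row_freeP; exists (D0 x).
have inv0 := @clim_inv_nat R G ultraG infG s (fun k => proj1 (sP k)).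
have : B0 (src a) *m (v a + 0 *: w a) *m (1%:M + (-1) *: (D0 (tgt a) *m B0 (tgt a))) = 0.
  apply: (@mxlim_unique R G ultraG _ _ (fun k => B k (src a) *m (v a + (s k)%:R^-1 *: w a)
    *m (1%:M + (-1) *: (D k (tgt a) *m B k (tgt a))))).
    apply: mxlimM; first apply: mxlimM => //.
      by apply: mxlimD; [apply: mxlim_cst | apply: mxlimZ => //; apply: mxlim_cst].
    apply: mxlimD; first exact: mxlim_cst.
    by apply: mxlimZ; [apply: clim_cst | apply: mxlimM].
  under eq_fun => k.
    have [_ /(_ a) eqk _] := BDP k; have [ltk _] := sP k.
    have -> : v a + (s k)%:R^-1 *: w a = (s k)%:R^-1 *: (w a + (s k)%:R *: v a).
      rewrite scalerDr scalerA mulVf ?scale1r 1?addrC // pnatr_eq0.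
      by rewrite -lt0n (leq_trans _ ltk).
    rewrite scaleN1r -scalemxAr -scalemxAl eqk scaler0. over.
  exact: mxlim_cst.
rewrite scale0r addr0 scaleN1r mulmxBr mulmx1 => /eqP; rewrite subr_eq0 => /eqP ->.
by rewrite mulmxA submxMl.
Qed.

End Closedness.

(** * The theorem *)

Lemma euler_form_eul (Q : quiver) (b n : dimvec Q) : (forall x, b x <= n x)%N ->
  euler_form (dimz b) (dimz n - dimz b) = eul b (fun x => n x - b x)%N.
Proof.
move=> le_bn; have subE x : (dimz n - dimz b) x = (n x - b x)%N%:Z.
  by rewrite !ffunE subzn.
rewrite /euler_form /eul.
rewrite !(big_morph Posz PoszD (erefl _)).
congr (_ - _); apply: eq_bigr => i _; rewrite subE !ffunE PoszM //.
Qed.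

Theorem theorem1p4 (R : realType) (Q : quiver) (alpha n : dimvec Q)
    (le_alpha_n : dimvec_le alpha n) :
  schofield_sub R[i] alpha n <->
  (forall beta : dimvec Q, schofield_sub R[i] beta alpha ->
     0 <= euler_form (dimz beta) (dimz n - dimz beta)).
Proof.
have closed_sub := @complex_sub_closed R Q.
split=> [/schofield_sub_gen sub_an beta /schofield_sub_gen sub_ba | pos].
  have sub_bn := gen_sub_trans sub_ba sub_an.
  rewrite euler_form_eul => [|x]; last exact: gen_sub_le sub_bn.
  exact: gen_sub_eul_ge0 sub_bn.
apply/schofield_sub_gen; pose gamma x := (n x - alpha x)%N.
have eq_n : (fun x => alpha x + gamma x)%N = n by apply/funext => x; apply: subnKC.
have [[V [W extVW]] | no_ext] := pselect (exists (V : mrep R[i] alpha)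
    (W : mrep R[i] gamma), ext_zero V W).
  by rewrite -eq_n; apply: ext_zero_gen_sub extVW.
have [|b [sub_ba neg_b rigid_b]] := @destabilizing_rigid _ _ closed_sub alpha gamma.
  apply: ext_nonzero_destabilizing => // V W extVW.
  by apply: no_ext; exists V, W.
have le_ba x := gen_sub_le x sub_ba.
pose beta : dimvec Q := [ffun x => b x].
have eq_b : b = beta by apply/funext => x; rewrite ffunE.
have : 0 <= euler_form (dimz beta) (dimz n - dimz beta).
  by apply/pos/schofield_sub_gen; rewrite -eq_b.
rewrite euler_form_eul => [|x]; last first.
  by rewrite ffunE (leq_trans (le_ba x)).
(* Splitting [n - b] as [(alpha - b) + gamma] writes the form as a nonpositive term plus a negative
   one. *)
rewrite -eq_b -(@eulDr _ b (fun x => alpha x - b x)%N gamma) => [|x].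
  by rewrite leNgt -[X in _ < X]addr0 ler_ltD.
have := le_ba x; have := le_alpha_n x; rewrite /gamma; lia.
Qed.
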